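(* Let $p\in[1,\infty)$, and let $\mu,\nu\in\mathcal M$ be absolutely continuous with respect to $\lambda$ with $\mu\ll\nu$. The error $d_p(\nu,\mu;S_1)$ is equal to zero or satisfies the inequality $$d_p(\mu;S_1)\le d_p(\nu,\mu;S_1)\le\infty .$$ If $d_p(\mu;S_1)>0$, then $d_p(\mu;S_1)=d_p(\nu,\mu;S_1)$ holds if and only if $\nu=a\mu$ for some constant $a\in(0,\infty)$.
   Context: $G=\mathbb Z$, and $\Gamma=[0,2\pi)$ (addition modulo $2\pi$, with the topology of the circle) is its dual group, with normalized Lebesgue measure $\lambda$ and characters $e_x(\gamma)=\mathrm e^{\mathrm ix\gamma}$, $x\in\mathbb Z$. $\mathcal M$ is the set of all non-zero finite non-negative (regular) Borel measures on $\Gamma$. $S_1:=\{1,2,3,\dots\}$, and $\mathcal T(S_1)$ is the complex linear span of $\{e_x:x\in S_1\}$ (finite sums). For $\mu\in\mathcal M$ and $p\in[1,\infty)$, $d_p(\mu;S_1):=\inf\{\int|1-\tau|^p\,d\mu:\tau\in\mathcal T(S_1)\}$, and $[\mathcal T(S_1)]_{\mu,p}$ is the closure of $\mathcal T(S_1)$ in $L^p(\mu)$. The metric projection $\phi_{\mu,p}(S_1)$ is the unique element of $[\mathcal T(S_1)]_{\mu,p}$ with $\int|1-\phi_{\mu,p}(S_1)|^p\,d\mu=d_p(\mu;S_1)$; for absolutely continuous $\mu$ and $p\in[1,\infty)$ it is known to exist. For $\mu\ll\nu$, $d_p(\nu,\mu;S_1):=\int|1-\phi_{\nu,p}(S_1)|^p\,d\mu\in[0,\infty]$.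 *)

(* Defs.v *)
From HB Require Import structures.
From mathcomp Require Import all_boot all_order all_algebra.
From mathcomp Require Import complex.
From mathcomp Require Import all_classical all_reals all_analysis.
Set Implicit Arguments.
Unset Strict Implicit.
Unset Printing Implicit Defensive.
Import Order.TTheory GRing.Theory Num.Theory.
Import numFieldNormedType.Exports.
Local Open Scope classical_set_scope.
Local Open Scope ring_scope.

(* The dual group of Z is realized as the interval [0, 2 pi) of the real line.
   A Borel measure on it is a Borel measure on R that vanishes off [0, 2 pi);
   this is the same thing, since the Borel sets of the circle are exactly the
   Borel subsets of [0, 2 pi). Finite Borel measures there are automatically
   regular. *)
Definition circle {R : realType} : set (measurableTypeR R) :=
  [set t : R | 0 <= t < 2 * pi].

Definition lambda {R : realType} (A : set (measurableTypeR R)) : \bar R :=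
  ((2 * pi)^-1%:E * lebesgue_measure (A `&` circle))%E.

Definition circle_measure {R : realType}
    (mu : {finite_measure set (measurableTypeR R) -> \bar R}) : Prop :=
  mu (~` circle) = 0%E /\ (0 < mu circle)%E.

Definition cmod {R : realType} (z : R[i]) : R := ComplexField.Normc.normc z.

Definition character {R : realType} (x : int) (t : R) : R[i] :=
  (cos (x%:~R * t) +i* sin (x%:~R * t))%C.

Definition trig_span {R : realType} (S : set int) : set (R -> R[i]) :=
  [set tau | exists (s : seq int) (c : int -> R[i]),
     (forall x, x \in s -> S x) /\
     tau = (fun t => \sum_(x <- s) c x * character x t)].

Definition lp_error {R : realType}
    (mu : {finite_measure set (measurableTypeR R) -> \bar R}) (p : R)
    (f : R -> R[i]) : \bar R :=
  \int[mu]_t (cmod (1 - f t) `^ p)%:E.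

Definition d_ {R : realType} (p : R)
    (mu : {finite_measure set (measurableTypeR R) -> \bar R})
    (S : set int) : \bar R :=
  ereal_inf [set lp_error mu p tau | tau in trig_span S].

Definition complex_Lnorm {R : realType}
    (mu : {finite_measure set (measurableTypeR R) -> \bar R}) (p : R)
    (f : R -> R[i]) : \bar R :=
  Lnorm mu p%:E (fun t => (cmod (f t))%:E).

(* The elements of the complex space L^p(mu) are represented by functions;
   two functions equal mu-a.e. represent the same element. *)
Definition complex_Lp {R : realType}
    (mu : {finite_measure set (measurableTypeR R) -> \bar R}) (p : R) :
    set (R -> R[i]) :=
  [set f | [/\ measurable_fun [set: measurableTypeR R]
                 (fun t => complex.Re (f t) : measurableTypeR R),
               measurable_fun [set: measurableTypeR R]
                 (fun t => complex.Im (f t) : measurableTypeR R)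
             & (complex_Lnorm mu p f < +oo)%E]].

Definition Lp_closure {R : realType}
    (mu : {finite_measure set (measurableTypeR R) -> \bar R}) (p : R)
    (V : set (R -> R[i])) : set (R -> R[i]) :=
  [set f | complex_Lp mu p f /\
     forall eps : R, 0 < eps ->
       exists2 tau, V tau &
         (complex_Lnorm mu p (fun t => (f t - tau t)%R) < eps%:E)%E].

(* phi represents the metric projection of the constant function 1 onto the
   L^p(mu)-closure of the trigonometric polynomials with frequencies in S. *)
Definition metric_projection {R : realType}
    (mu : {finite_measure set (measurableTypeR R) -> \bar R}) (p : R)
    (S : set int) (phi : R -> R[i]) : Prop :=
  Lp_closure mu p (trig_span S) phi /\ lp_error mu p phi = d_ p mu S.

Definition S1 : set int := [set x : int | 1 <= x].

(* Main.v *)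
Require Import Defs.
From HB Require Import structures.
From mathcomp Require Import all_boot all_order all_algebra.
From mathcomp Require Import complex.
From mathcomp Require Import all_classical all_reals all_analysis.
From mathcomp Require Import measurable_realfun ring lra.
Import Order.TTheory GRing.Theory Num.Theory.
Import numFieldNormedType.Exports.
Local Open Scope classical_set_scope.
Local Open Scope ring_scope.

Set Implicit Arguments.
Unset Strict Implicit.
Unset Printing Implicit Defensive.

(** Write psi = 1 - phi_nu, V = |psi|^p, and d(.) for d_p(. ; S1); polynomials Q
are always of the form 1 - tau with tau in T(S1), a family closed under
products, and means are taken against normalized Lebesgue measure lambda.

The engine is an exponential form of the upper bound in Szego's theorem
([szego_inequality]). If a weight W in L^1(rho) satisfies
c <= int |Q|^p W drho for all Q, then
  c exp(mean f) <= int exp(f) W drho  for every bounded Borel function f.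
For f = Re sigma with sigma in T(S1), take Q = (1 + sigma/(pN))^N: its modulus
to the power p is at most exp(Re sigma + O(1/N)), by 1 + x <= exp(x). Both sides
are stable under bounded pointwise limits of f, and iterated limits of
trigonometric polynomials give all bounded Borel functions
([bm_trig_limit]). If moreover c = int W drho, then both sides agree at
f = 0, and comparing their first-order terms there gives W rho = c lambda
([mean_eq_of_szego]).

Three choices of the weight give the theorem. First, Q(1 - tau_n), where tau_n
tends to phi_nu, is again a polynomial of the family, hence
d(nu) <= int |Q|^p V dnu ([projection_minimal]); equality holds for Q = 1, so
V nu = d(nu) lambda ([projection_mean]). In particular, if d(nu) = 0 then V
vanishes nu-almost everywhere, hence mu-almost everywhere, and the error is
zero. Suppose from now on that d(nu) > 0.

Second, by Bernoulli's inequality the mean of |Q|^p is at least 1 for every Q,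
so the inequality holds with rho = lambda, W = |Q|^p, c = 1. With f = - log V
(truncated) and V^-1 lambda = nu / d(nu) it reads
exp(- mean (log V)) <= int |Q|^p dnu / d(nu), and the infimum over Q of the
right-hand side is 1. So mean (log V) >= 0 ([log_mean_clamp]).

Third, take rho = mu, W = 1, c = d(mu), and log V + f (truncated) as
exponent: since mean (log V) >= 0,
  d(mu) exp(mean f) <= int exp(f) V dmu
([error_lower_bound]). At f = 0 this is the inequality d(mu) <= d(nu, mu). If
equality holds there, the first-order comparison applies again and gives
V mu = d(mu) lambda; together with V nu = d(nu) lambda and the fact that {V = 0}
is a null set, nu = (d(nu) / d(mu)) mu. Conversely, proportional measures have
proportional errors and the same metric projection. *)

(** * Bounded measurable functions and normalized Lebesgue measure *)

Section bounded_functions.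
Context {R : realType}.
Local Notation T := (measurableTypeR R).
Local Notation circle := (@circle R).
Local Notation leb := (@lebesgue_measure R).

Lemma circle_itv : circle = `[0, 2 * pi[%classic.
Proof. by apply/seteqP; split=> t; rewrite /circle /= in_itv. Qed.

Lemma measurable_circle : measurable circle.
Proof. rewrite circle_itv; exact: measurable_itv. Qed.

#[local] Hint Resolve measurable_circle : core.

Lemma twopi_gt0 : 0 < 2 * pi :> R.
Proof. by rewrite mulr_gt0 ?pi_gt0. Qed.

Lemma leb_circle : leb circle = (2 * pi)%:E.
Proof.
by rewrite circle_itv lebesgue_measure_itv /= lte_fin twopi_gt0 oppr0 adde0.
Qed.

Definition bounded_on_circle (f : R -> R) :=
  exists C, forall t, circle t -> `|f t| <= C.

Definition bounded_measurable (f : R -> R) :=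
  measurable_fun circle f /\ bounded_on_circle f.

Lemma integrable_bddM (rho : {measure set T -> \bar R}) (W f : R -> R) :
  rho.-integrable circle (EFin \o W) -> bounded_measurable f ->
  rho.-integrable circle (EFin \o (fun t => f t * W t)).
Proof.
move=> iW [mf [C fC]].
have := @integrableMr _ _ _ rho circle measurable_circle f (EFin \o W) mf _ iW.
apply; exists C; split; first exact: num_real.
by move=> x Cx t /fC /le_trans; apply; exact: ltW.
Qed.

Lemma bmD f g : bounded_measurable f -> bounded_measurable g ->
  bounded_measurable (fun t => f t + g t).
Proof.
move=> [mf [C fC]] [mg [D gD]]; split; first exact: measurable_funD.
exists (C + D) => t ct.
by rewrite (le_trans (ler_normD _ _))// lerD ?fC ?gD.
Qed.

Lemma bmM f g : bounded_measurable f -> bounded_measurable g ->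
  bounded_measurable (fun t => f t * g t).
Proof.
move=> [mf [C fC]] [mg [D gD]]; split; first exact: measurable_funM.
by exists (C * D) => t ct; rewrite normrM ler_pM ?fC ?gD.
Qed.

Lemma bm_cst c : bounded_measurable (fun=> c).
Proof. by split; [exact: measurable_cst|exists `|c| => t _]. Qed.

Lemma bmZ c f : bounded_measurable f -> bounded_measurable (fun t => c * f t).
Proof. by move=> bf; exact: bmM (bm_cst c) bf. Qed.

Lemma bm_expR f : bounded_measurable f ->
  bounded_measurable (fun t => expR (f t)).
Proof.
move=> [mf [C fC]]; split; first exact: measurableT_comp.
exists (expR C) => t ct; rewrite ger0_norm ?expR_ge0// ler_expR.
by rewrite (le_trans (ler_norm _))// fC.
Qed.

Lemma bm_invr_max (a : R) (g : R -> R) : 0 < a -> measurable_fun circle g ->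
  bounded_measurable (fun t => (Num.max a (g t))^-1).
Proof.
move=> a0 mg; have max0 t : 0 < Num.max a (g t) by rewrite lt_max a0.
split.
  rewrite (_ : (fun _ => _) = fun t => expR (- ln (Num.max a (g t)))).
    apply: measurableT_comp => //; apply: measurableT_comp => //.
    apply: (@measurableT_comp _ _ _ T R R (@ln R)); first exact: measurable_ln.
    by apply: measurable_maxr => //; exact: measurable_cst.
  by apply/funext => t; rewrite expRN lnK// posrE.
exists a^-1 => t _; rewrite ger0_norm ?invr_ge0 ?(ltW (max0 _))//.
by rewrite lef_pV2 ?posrE// le_max lexx.
Qed.

Lemma bm_indic (A : set T) : measurable A ->
  bounded_measurable (\1_A : R -> R).
Proof.
move=> mA; split; first exact: measurable_indic.
by exists 1 => t _; rewrite indicE; case: (_ \in _); rewrite ?normr1 ?normr0.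
Qed.

Lemma integrable_cst_leb (c : R) : leb.-integrable circle (EFin \o cst c).
Proof.
apply/integrableP; split; first exact/measurable_EFinP/measurable_cst.
rewrite [ltLHS](_ : _ = (\int[leb]_(t in circle) `|c|%:E)%E)//.
by rewrite integral_cst//= leb_circle -EFinM ltry.
Qed.

Lemma integrable_leb f : bounded_measurable f ->
  leb.-integrable circle (EFin \o f).
Proof.
move=> bf; have := integrable_bddM (integrable_cst_leb 1) bf.
by congr (leb.-integrable circle _); apply/funext=> t; rewrite /= mulr1.
Qed.

Lemma integrable_fin (rho : {finite_measure set T -> \bar R}) f :
  bounded_measurable f -> rho.-integrable circle (EFin \o f).
Proof.
have i1 : rho.-integrable circle (EFin \o cst 1).
  apply/integrableP; split; first exact/measurable_EFinP/measurable_cst.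
  rewrite [ltLHS](_ : _ = (\int[rho]_(t in circle) `|1%R|%:E)%E)//.
  rewrite integral_cst// normr1 mul1e.
  by rewrite -ge0_fin_numE ?fin_num_measure.
move=> bf; have := integrable_bddM i1 bf.
by congr (rho.-integrable circle _); apply/funext=> t; rewrite /= mulr1.
Qed.

Definition mean (f : R -> R) : R :=
  (2 * pi)^-1 * \int[leb]_(t in circle) f t.

Lemma mean_cst c : mean (fun=> c) = c.
Proof.
rewrite /mean Rintegral_cst//= leb_circle /= mulrC -mulrA divff ?mulr1//.
by rewrite gt_eqF// twopi_gt0.
Qed.

Lemma meanD f g : bounded_measurable f -> bounded_measurable g ->
  mean (fun t => f t + g t) = mean f + mean g.
Proof.
move=> bf bg; rewrite /mean RintegralD ?mulrDr//; exact: integrable_leb.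
Qed.

Lemma meanZ c f : bounded_measurable f ->
  mean (fun t => c * f t) = c * mean f.
Proof.
move=> bf; rewrite /mean RintegralZl// 1?mulrCA//; exact: integrable_leb.
Qed.

Lemma le_mean f g : bounded_measurable f -> bounded_measurable g ->
  (forall t, circle t -> f t <= g t) -> mean f <= mean g.
Proof.
move=> bf bg fg; rewrite /mean ler_wpM2l// ?invr_ge0 ?(ltW twopi_gt0)//.
by apply: le_Rintegral => //; exact: integrable_leb.
Qed.

Lemma Rintegral_dominated (rho : {measure set T -> \bar R})
    (u : nat -> R -> R) (f g : R -> R) :
  (forall n, measurable_fun circle (u n)) -> measurable_fun circle f ->
  rho.-integrable circle (EFin \o g) ->
  (forall n t, circle t -> `|u n t| <= g t) ->
  (forall t, circle t -> u ^~ t @ \oo --> f t) ->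
  (\int[rho]_(t in circle) u n t)%R @[n --> \oo]
    --> (\int[rho]_(t in circle) f t)%R.
Proof.
move=> mu_ mf ig ug uf.
have [] := @dominated_convergence _ _ _ rho circle measurable_circle
  (fun n => EFin \o u n) (EFin \o f) (EFin \o g) _ _ _ ig _.
- by move=> n; exact/measurable_EFinP.
- exact/measurable_EFinP.
- by apply: aeW => t ct; apply/cvg_EFin; [exact: nearW|exact: uf].
- by apply: aeW => t n ct; rewrite /= lee_fin; exact: ug.
move=> fi _ cvgi; apply: fine_cvg.
by rewrite fineK ?integrable_fin_num.
Qed.

End bounded_functions.

#[local] Hint Resolve measurable_circle : core.

(** * Trigonometric polynomials *)

Section trig_polynomials.
Context {R : realType}.
Implicit Types (l : seq (int * R[i])) (S : set int).

Lemma Re_addc (z w : R[i]) : complex.Re (z + w) = complex.Re z + complex.Re w.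
Proof. by case: z w => [a b] [c d]. Qed.

Lemma Im_addc (z w : R[i]) : complex.Im (z + w) = complex.Im z + complex.Im w.
Proof. by case: z w => [a b] [c d]. Qed.

Lemma Re_mulc (z w : R[i]) : complex.Re (z * w) =
  complex.Re z * complex.Re w - complex.Im z * complex.Im w.
Proof. by case: z w => [a b] [c d]. Qed.

Lemma Im_mulc (z w : R[i]) : complex.Im (z * w) =
  complex.Re z * complex.Im w + complex.Im z * complex.Re w.
Proof. by case: z w => [a b] [c d]. Qed.

Lemma cmodE (z : R[i]) :
  cmod z = Num.sqrt (complex.Re z ^+ 2 + complex.Im z ^+ 2).
Proof. by case: z. Qed.

Lemma cmod_ge0 (z : R[i]) : 0 <= cmod z.
Proof. by rewrite cmodE sqrtr_ge0. Qed.

Lemma cmodM (z w : R[i]) : cmod (z * w) = cmod z * cmod w.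
Proof. exact: ComplexField.Normc.normcM. Qed.

Lemma cmod0 : cmod (0 : R[i]) = 0.
Proof. exact: ComplexField.Normc.normc0. Qed.

Lemma cmod1 : cmod (1 : R[i]) = 1.
Proof. exact: ComplexField.Normc.normc1. Qed.

Lemma cmodX (z : R[i]) n : cmod (z ^+ n) = cmod z ^+ n.
Proof.
elim: n => [|n IH]; first exact: cmod1.
by rewrite !exprS cmodM IH.
Qed.

Lemma ler_cmodD (z w : R[i]) : cmod (z + w) <= cmod z + cmod w.
Proof. exact: le_normcD. Qed.

Lemma ler_Re_cmod (z : R[i]) : `|complex.Re z| <= cmod z.
Proof. by rewrite cmodE -sqrtr_sqr ler_wsqrtr// lerDl sqr_ge0. Qed.

Lemma cmod_character x (t : R) : cmod (character x t) = 1.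
Proof. by rewrite /cmod /= cos2Dsin2 sqrtr1. Qed.

Lemma characterD x y (t : R) :
  character (x + y) t = character x t * character y t.
Proof.
rewrite /character intrD mulrDl cosD sinD; apply/eqP.
by rewrite eq_complex /= eqxx /= addrC (mulrC (cos _)) eqxx.
Qed.

Lemma character0 (t : R) : character 0 t = 1.
Proof. by rewrite /character mulr0z mul0r cos0 sin0. Qed.

Lemma characterN x (t : R) : character (- x) t = (character x t)^*%C.
Proof. by rewrite /character mulrNz mulNr cosN sinN. Qed.

(** A trigonometric polynomial given by its list of (frequency, coefficient)
    pairs, in which a frequency may be repeated, so that sums are concatenations
    and induction on terms is available. *)
Definition trig_poly l (t : R) : R[i] :=
  \sum_(q <- l) q.2 * character q.1 t.

(** The definition of the span takes one coefficient per frequency; grouping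
    equal frequencies recovers it from an arbitrary list of terms. *)
Lemma trig_spanP S (tau : R -> R[i]) :
  trig_span S tau <->
  exists l, (forall q, q \in l -> S q.1) /\ tau = trig_poly l.
Proof.
split=> [[s [c [sS ->]]]|[l [lS ->]]].
  exists [seq (x, c x) | x <- s]; split.
    by move=> _ /mapP[x xs ->]; exact: sS.
  by apply/funext=> t; rewrite /trig_poly big_map.
exists (undup (unzip1 l)), (fun x => \sum_(q <- l | q.1 == x) q.2); split.
  by move=> x; rewrite mem_undup => /mapP[q ql ->]; exact: lS.
apply/funext=> t; rewrite /trig_poly.
(* The coefficient of x collects the terms of frequency x; each term of l is
   hit by exactly one x of the duplicate-free list. *)
under [RHS]eq_bigr do rewrite mulr_suml.
rewrite (exchange_big_dep xpredT)//= big_seq [RHS]big_seq.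
apply: eq_bigr => q ql; rewrite -big_filter.
suff -> : [seq i <- undup (unzip1 l) | q.1 == i] = [:: q.1] by rewrite big_seq1.
rewrite (@eq_filter _ _ (pred1 q.1)); last by move=> x /=; rewrite eq_sym.
by rewrite filter_pred1_uniq ?undup_uniq// mem_undup map_f.
Qed.

Lemma trig_span_poly S l :
  (forall q, q \in l -> S q.1) -> trig_span S (trig_poly l).
Proof. by move=> lS; apply/trig_spanP; exists l. Qed.

Lemma trig_span_eq S (f g : R -> R[i]) :
  trig_span S f -> (forall t, f t = g t) -> trig_span S g.
Proof. by move=> Sf /funext <-. Qed.

Lemma trig_span0 S : trig_span S (fun=> 0 : R[i]).
Proof.
apply: (@trig_span_eq S (trig_poly [::])); first exact: trig_span_poly.
by move=> t; rewrite /trig_poly big_nil.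
Qed.

Lemma trig_span_mono S x (c : R[i]) : S x ->
  trig_span S (fun t => c * character x t).
Proof.
move=> Sx; apply: (@trig_span_eq S (trig_poly [:: (x, c)])).
  by apply: trig_span_poly => q; rewrite inE => /eqP ->.
by move=> t; rewrite /trig_poly big_seq1.
Qed.

Lemma trig_spanD S (f g : R -> R[i]) :
  trig_span S f -> trig_span S g -> trig_span S (fun t => f t + g t).
Proof.
move=> /trig_spanP[l [lS ->]] /trig_spanP[l' [lS' ->]].
apply: (@trig_span_eq S (trig_poly (l ++ l'))).
  by apply: trig_span_poly => q; rewrite mem_cat => /orP[/lS|/lS'].
by move=> t; rewrite /trig_poly big_cat.
Qed.

Lemma trig_span_ind S (P : (R -> R[i]) -> Prop) :
  P (fun=> 0) ->
  (forall x c f, S x -> trig_span S f -> P f ->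
    P (fun t => c * character x t + f t)) ->
  forall f, trig_span S f -> P f.
Proof.
move=> P0 PD _ /trig_spanP[l [lS ->]].
rewrite /trig_poly; elim: l lS => [|[x c] l IH] lS.
  by under eq_fun do rewrite big_nil.
under eq_fun do rewrite big_cons.
have lS' q : q \in l -> S q.1 by move=> ql; apply: lS; rewrite inE ql orbT.
apply: PD; [by apply: (lS (x, c)); rewrite inE eqxx| |exact: IH].
exact: trig_span_poly.
Qed.

(** Frequencies add under multiplication, so any set of frequencies closed
    under addition spans a set closed under products. *)
Lemma trig_spanM S (f g : R -> R[i]) :
  (forall x y, S x -> S y -> S (x + y)) ->
  trig_span S f -> trig_span S g -> trig_span S (fun t => f t * g t).
Proof.
move=> SD Sf Sg; elim/trig_span_ind: Sf => [|x c {}f Sx _ IH].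
  by apply: trig_span_eq (trig_span0 S) _ => t; rewrite mul0r.
have Sxg : trig_span S (fun t => c * character x t * g t).
  elim/trig_span_ind: Sg {IH} => [|y d {}g Sy _ IH].
    by apply: trig_span_eq (trig_span0 S) _ => t; rewrite mulr0.
  apply: trig_span_eq (trig_spanD (trig_span_mono (c * d) (SD x y Sx Sy)) IH) _.
  by move=> t; rewrite characterD mulrDr mulrACA.
by apply: trig_span_eq (trig_spanD Sxg IH) _ => t; rewrite mulrDl.
Qed.

Lemma trig_spanZ S c (f : R -> R[i]) :
  trig_span S f -> trig_span S (fun t => c * f t).
Proof.
elim/trig_span_ind=> [|x d {}f Sx _ IH].
  by apply: trig_span_eq (trig_span0 S) _ => t; rewrite mulr0.
apply: trig_span_eq (trig_spanD (trig_span_mono (c * d) Sx) IH) _.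
by move=> t; rewrite mulrDr mulrA.
Qed.

Lemma trig_span_bounded S (f : R -> R[i]) : trig_span S f ->
  exists2 C, 0 <= C & forall t, cmod (f t) <= C.
Proof.
elim/trig_span_ind=> [|x c {}f _ _ [C C0 fC]].
  by exists 0 => // t; rewrite cmod0.
exists (cmod c + C); first by rewrite addr_ge0// cmod_ge0.
move=> t; rewrite (le_trans (ler_cmodD _ _))// lerD//.
by rewrite cmodM cmod_character mulr1.
Qed.

Lemma trig_span_measurable S (f : R -> R[i]) : trig_span S f ->
  measurable_fun [set: R] (fun t => complex.Re (f t)) /\
  measurable_fun [set: R] (fun t => complex.Im (f t)).
Proof.
have mchar x : measurable_fun [set: R] (fun t : R => cos (x%:~R * t)) /\
    measurable_fun [set: R] (fun t : R => sin (x%:~R * t)).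
  by split; apply: continuous_measurable_fun => t; apply: continuous_comp;
    do ?[exact: mulrl_continuous|exact: continuous_cos|exact: continuous_sin].
elim/trig_span_ind=> [|x c {}f _ _ [mR mI]]; first by split=> /=; exact: measurable_cst.
have [mc ms] := mchar x; split.
  under eq_fun do rewrite Re_addc Re_mulc /=.
  apply: measurable_funD => //; apply: measurable_funB; exact: measurable_funM.
under eq_fun do rewrite Im_addc Im_mulc /=.
apply: measurable_funD => //; apply: measurable_funD; exact: measurable_funM.
Qed.

End trig_polynomials.

(** * Bounded pointwise limits of trigonometric polynomials *)

Section bounded_limits.
Context {R : realType}.
Local Notation T := (measurableTypeR R).
Local Notation circle := (@circle R).

Lemma bm_eq (f g : R -> R) : bounded_measurable f ->
  (forall t, circle t -> f t = g t) -> bounded_measurable g.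
Proof.
move=> [mf [C fC]] fg; split.
  apply: (eq_measurable_fun f) => // t; rewrite inE; exact: fg.
by exists C => t ct; rewrite -fg// fC.
Qed.

Lemma trig_span_bm S (tau : R -> R[i]) : trig_span S tau ->
  bounded_measurable (fun t => complex.Re (tau t)).
Proof.
move=> St; split.
  have [mR _] := trig_span_measurable St.
  exact: (@measurable_funTS _ _ T R circle _ mR).
have [C _ tC] := trig_span_bounded St.
by exists C => t _; rewrite (le_trans (ler_Re_cmod _)).
Qed.

(** The smallest class of functions that contains the real trigonometric
    polynomials and is closed under bounded pointwise limits on the circle.
    Taking limits of limits makes it reach every bounded Borel function, which
    no single sequence of trigonometric polynomials would do pointwise. *)
Inductive trig_limit : (R -> R) -> Prop :=
| trig_limit_trig tau : trig_span [set: int] tau ->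
    trig_limit (fun t => complex.Re (tau t))
| trig_limit_lim u f C : (forall n : nat, trig_limit (u n)) ->
    (forall n t, circle t -> `|u n t| <= C) ->
    (forall t, circle t -> u ^~ t @ \oo --> f t) -> trig_limit f.

Lemma trig_limit_bm f : trig_limit f -> bounded_measurable f.
Proof.
elim=> [tau /trig_span_bm//|u {}f C _ IH uC uf]; split.
  by apply: (@measurable_fun_cvg _ T R circle u f) => [n|t]; [case: (IH n)|exact: uf].
exists C => t ct; have /cvg_norm uft := uf t ct.
rewrite -(cvg_lim _ uft)//; apply: limr_le; first by apply/cvg_ex; eexists; exact: uft.
by apply: nearW => n; exact: uC.
Qed.

Lemma trig_limit_eq f g : trig_limit f -> (forall t, circle t -> f t = g t) ->
  trig_limit g.
Proof.
move=> lf fg; have [_ [C fC]] := trig_limit_bm lf.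
(* The constant sequence f converges to g on the circle. *)
apply: (@trig_limit_lim (fun=> f) g C) => // t ct.
by rewrite -fg//; exact: cvg_cst.
Qed.

Lemma trig_limit_cst c : trig_limit (fun=> c).
Proof.
have lc := trig_limit_trig (trig_span_mono c%:C%C (I : [set: int] 0)).
apply: trig_limit_eq lc _ => t _.
by rewrite character0 mulr1.
Qed.

(** Nested induction: first g runs through the class with f a polynomial, then
    f runs through it with g fixed. *)
Lemma trig_limitD f g : trig_limit f -> trig_limit g ->
  trig_limit (fun t => f t + g t).
Proof.
move=> lf lg; elim: lf => [tau ttau|u {}f C lu IH uC uf].
  elim: lg => [tau' ttau'|u {}g C lu IH uC uf].
    apply: trig_limit_eq (trig_limit_trig (trig_spanD ttau ttau')) _ => t _.
    by rewrite Re_addc.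
  have [_ [D gD]] := trig_span_bm ttau.
  apply: (trig_limit_lim IH (C := D + C)) => [n t ct|t ct].
    by rewrite (le_trans (ler_normD _ _))// lerD ?gD ?uC.
  by apply: cvgD; [exact: cvg_cst|exact: uf].
have [_ [D gD]] := trig_limit_bm lg.
apply: (trig_limit_lim IH (C := C + D)) => [n t ct|t ct].
  by rewrite (le_trans (ler_normD _ _))// lerD ?gD ?uC.
by apply: cvgD; [exact: uf|exact: cvg_cst].
Qed.

Lemma trig_span_conj (tau : R -> R[i]) : trig_span [set: int] tau ->
  trig_span [set: int] (fun t => (tau t)^*%C).
Proof.
apply: (@trig_span_ind R setT (fun f => trig_span setT (fun t => (f t)^*%C))).
  by apply: trig_span_eq (trig_span0 _) _ => t; rewrite rmorph0.
move=> x d f _ _ IH.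
apply: trig_span_eq (trig_spanD (trig_span_mono d^*%C (I : [set: int] (- x))) IH) _.
by move=> t; rewrite rmorphD rmorphM characterN.
Qed.

(** A product of real parts is the real part of f (g + conj g) / 2; this uses
    negative frequencies. *)
Lemma trig_span_ReM (f g : R -> R[i]) :
  trig_span [set: int] f -> trig_span [set: int] g ->
  exists2 h, trig_span [set: int] h &
    forall t, complex.Re (h t) = complex.Re (f t) * complex.Re (g t).
Proof.
move=> tf tg.
exists (fun t => (2^-1)%:C%C * (f t * (g t + (g t)^*%C))).
  apply: trig_spanZ; apply: trig_spanM => //; apply: trig_spanD => //.
  exact: trig_span_conj.
by move=> t; case: (f t) (g t) => [a b] [c d] /=; field.
Qed.

Lemma trig_limitM f g : trig_limit f -> trig_limit g ->
  trig_limit (fun t => f t * g t).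
Proof.
move=> lf lg; elim: lf => [tau ttau|u {}f C lu IH uC uf].
  elim: lg => [tau' ttau'|u {}g C lu IH uC uf].
    have [h th hE] := trig_span_ReM ttau ttau'.
    by apply: trig_limit_eq (trig_limit_trig th) _ => t _.
  have [_ [D gD]] := trig_span_bm ttau.
  apply: (trig_limit_lim IH (C := D * C)) => [n t ct|t ct].
    by rewrite normrM ler_pM ?gD ?uC.
  by apply: cvgM; [exact: cvg_cst|exact: uf].
have [_ [D gD]] := trig_limit_bm lg.
apply: (trig_limit_lim IH (C := C * D)) => [n t ct|t ct].
  by rewrite normrM ler_pM ?gD ?uC.
by apply: cvgM; [exact: uf|exact: cvg_cst].
Qed.

Lemma trig_limitZ c f : trig_limit f -> trig_limit (fun t => c * f t).
Proof. by move=> lf; exact: trig_limitM (trig_limit_cst c) lf. Qed.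

Lemma trig_limitX f n : trig_limit f -> trig_limit (fun t => f t ^+ n).
Proof.
move=> lf; elim: n => [|n IH]; first exact: trig_limit_cst.
by under eq_fun do rewrite exprS; exact: trig_limitM.
Qed.

Lemma trig_limit_sum (I : Type) (r : seq I) (F : I -> R -> R) :
  (forall i, trig_limit (F i)) -> trig_limit (fun t => \sum_(i <- r) F i t).
Proof.
move=> lF; elim: r => [|i r IH].
  by under eq_fun do rewrite big_nil; exact: trig_limit_cst.
by under eq_fun do rewrite big_cons; exact: trig_limitD.
Qed.

End bounded_limits.

(** * Bounded Borel functions as iterated limits *)

Section bounded_borel_functions.
Context {R : realType}.
Local Notation T := (measurableTypeR R).
Local Notation circle := (@circle R).

(** Polynomials in x that increase to |x| on [-1, 1]. *)
Fixpoint abs_iter (x : R) (n : nat) : R :=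
  if n is n.+1 then
    let y := abs_iter x n in y + (x ^+ 2 - y ^+ 2) / 2
  else 0.

(** The error e = |x| - y satisfies e' = e (1 - (|x| + y) / 2). *)
Lemma abs_iter_bounds (x : R) n : `|x| <= 1 ->
  0 <= abs_iter x n <= `|x| /\
  `|x| - abs_iter x n <= geometric `|x| (1 - `|x| / 2) n.
Proof.
move=> x1; have x0 := normr_ge0 x.
elim: n => [|n [/andP[y0 yx] IH]] /=.
  by rewrite lexx x0 /= subr0 expr0 mulr1.
move: IH; rewrite /geometric /= -(real_normK (num_real x)) [(1 - _) ^+ n.+1]exprS.
set y := abs_iter x n in y0 yx *; set a := `|x| in x0 x1 yx *.
set e := (1 - a / 2) ^+ n => IH.
have step : a - (y + (a ^+ 2 - y ^+ 2) / 2) = (a - y) * (1 - (a + y) / 2).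
  by field.
split; first by apply/andP; split; nra.
rewrite step (le_trans (y := (a - y) * (1 - a / 2)))//; first by nra.
by rewrite mulrCA mulrC ler_wpM2l//; nra.
Qed.

Lemma cvg_abs_iter (x : R) : `|x| <= 1 -> abs_iter x n @[n --> \oo] --> `|x|.
Proof.
move=> x1; have bnd n := abs_iter_bounds n x1.
have [x0|x0] := eqVneq x 0.
  rewrite (_ : abs_iter x = cst `|x|); first exact: cvg_cst.
  apply/funext => n; have [/andP[y0 yx] _] := bnd n.
  by apply: le_anti; rewrite yx /= (le_trans _ y0)// x0 normr0.
apply: (@squeeze_cvgr _ _ _ _
  (fun n => `|x| - geometric `|x| (1 - `|x| / 2) n) (cst `|x|)).
- by apply: nearW => n; have [/andP[_ ->] h] := bnd n; rewrite lerBlDr -lerBlDl h.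
- rewrite -[X in _ --> X]subr0; apply: cvgB; first exact: cvg_cst.
  have ax : 0 < `|x| by rewrite normr_gt0.
  by apply: cvg_geometric; rewrite ger0_norm; lra.
- exact: cvg_cst.
Qed.

Lemma trig_limit_bound (f : R -> R) : trig_limit f ->
  exists2 C : R, 0 < C & forall t, circle t -> `|f t| <= C.
Proof.
move=> /trig_limit_bm[_ [C fC]]; exists (`|C| + 1); first by rewrite ltr_wpDl.
by move=> t /fC /le_trans; apply; rewrite ler_wpDr// ler_norm.
Qed.

Lemma trig_limit_abs (f : R -> R) : trig_limit f -> trig_limit (fun t => `|f t|).
Proof.
move=> lf; have [C C0 fC] := trig_limit_bound lf.
have lg := trig_limitZ C^-1 lf; set g := (fun t => _ * f t) in lg.
have g1 t : circle t -> `|g t| <= 1.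
  move=> ct; rewrite normrM gtr0_norm ?invr_gt0// mulrC ler_pdivrMr// mul1r.
  exact: fC.
have labs : trig_limit (fun t => `|g t|).
  apply: (@trig_limit_lim _ (fun n t => abs_iter (g t) n) _ 1).
  - elim=> [|n IH] /=; first exact: trig_limit_cst.
    have l2 := trig_limitD (trig_limitX 2 lg) (trig_limitZ (- 1) (trig_limitX 2 IH)).
    apply: trig_limit_eq (trig_limitD IH (trig_limitZ 2^-1 l2)) _ => t _.
    by rewrite mulN1r mulrC [in RHS]addrC addrC.
  - move=> n t ct; have [/andP[y0 yx] _] := abs_iter_bounds n (g1 t ct).
    by rewrite ger0_norm// (le_trans yx)// g1.
  - by move=> t ct; apply: cvg_abs_iter; exact: g1.
apply: trig_limit_eq (trig_limitZ C labs) _ => t _.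
by rewrite /g normrM gtr0_norm ?invr_gt0// mulrA divff ?mul1r// gt_eqF.
Qed.

(** With h in [0, 1] positive exactly where f is, 1 - (1 - h)^n increases to
    the indicator of f > 0. *)
Lemma trig_limit_gt0 (f : R -> R) : trig_limit f -> trig_limit (fun t => (0 < f t)%R%:R).
Proof.
move=> lf; have [C C0 fC] := trig_limit_bound lf.
(* Twice the positive part of f, scaled into [0, 1]. *)
pose h t := (2 * C)^-1 * (`|f t| + f t).
have lh : trig_limit h.
  by apply: trig_limitZ; apply: trig_limitD => //; exact: trig_limit_abs.
have l1h := trig_limitD (trig_limit_cst 1) (trig_limitZ (-1) lh).
have C20 : 0 < 2 * C by rewrite mulr_gt0.
have h01 t : circle t -> 0 <= h t <= 1.
  move=> ct; rewrite /h mulr_ge0 ?invr_ge0 ?(ltW C20)//=; last first.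
    by have := ler_norm (- f t); rewrite normrN; lra.
  rewrite mulrC ler_pdivrMr// mul1r.
  by have := fC t ct; have := ler_norm (f t); lra.
apply: (@trig_limit_lim _ (fun n t => 1 - (1 - h t) ^+ n) _ 1).
- move=> n; have ln := trig_limitZ (-1) (trig_limitX n l1h).
  apply: trig_limit_eq (trig_limitD (trig_limit_cst 1) ln) _ => t _.
  by rewrite !mulN1r.
- move=> n t ct; have /andP[h0 h1] := h01 t ct.
  have e0 : 0 <= (1 - h t) ^+ n by rewrite exprn_ge0// subr_ge0.
  have e1 : (1 - h t) ^+ n <= 1 by rewrite exprn_ile1 ?subr_ge0// gerBl.
  by rewrite ger0_norm; lra.
- move=> t ct; have /andP[h0 h1] := h01 t ct.
  have [ft|ft] := ltrP 0 (f t).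
    have ht : 0 < h t by rewrite mulr_gt0 ?invr_gt0// ltr_wpDl.
    rewrite -[X in _ --> X]subr0; apply: cvgB; first exact: cvg_cst.
    by apply: cvg_expr; rewrite ger0_norm; lra.
  have ht : h t = 0 by rewrite /h ler0_norm// addNr mulr0.
  rewrite ht subr0; under eq_fun do rewrite expr1n subrr.
  exact: cvg_cst.
Qed.

Definition trig_limit_set (A : set R) := trig_limit (fun t => \1_A t).

Lemma trig_limit_setC A : trig_limit_set A -> trig_limit_set (~` A).
Proof.
move=> lA; have l1A := trig_limitD (trig_limit_cst 1) (trig_limitZ (-1) lA).
apply: trig_limit_eq l1A _ => t _.
by rewrite !indicE in_setC mulN1r; case: (t \in A); rewrite ?subrr ?subr0.
Qed.

(** For indicators, 1 - prod (1 - 1_(F i)) is the indicator of the finite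
    union. *)
Lemma trig_limit_bigcup (F : (set R)^nat) :
  (forall n, trig_limit_set (F n)) -> trig_limit_set (\bigcup_n F n).
Proof.
move=> lF.
apply: (@trig_limit_lim _ (fun n t => 1 - \prod_(i < n) (1 - \1_(F i) t)) _ 1).
- move=> n; apply: (@trig_limit_eq _
    (fun t => 1 + (-1) * \prod_(i < n) (1 - \1_(F i) t))).
    apply: trig_limitD; first exact: trig_limit_cst.
    apply: trig_limitZ; elim: n => [|n IH].
      by under eq_fun do rewrite big_ord0; exact: trig_limit_cst.
    under eq_fun do rewrite big_ord_recr /=; apply: trig_limitM => //.
    apply: trig_limit_eq (trig_limit_setC (lF n)) _ => t _.
    by rewrite !indicE in_setC; case: (t \in _); rewrite ?subrr ?subr0.
  by move=> t _; rewrite mulN1r.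
- move=> n t _; pose P : R := \prod_(i < n) (1 - \1_(F i) t).
  have : 0 <= P <= 1.
    rewrite /P.
    elim/big_ind: _ => [|x y|i _].
    + by rewrite lexx ler01.
    + by move=> /andP[x0 x1] /andP[y0 y1]; rewrite mulr_ge0//= mulr_ile1.
    + by rewrite indicE; case: (_ \in _); rewrite ?subrr ?subr0 ?lexx ?ler01.
  by move=> /andP[p0 p1]; rewrite -/P ger0_norm; lra.
- move=> t _; rewrite indicE.
  have [|tF'] := boolP (t \in _).
    rewrite inE => -[m _ Fmt]; apply: cvg_near_cst.
    near=> n; have mn : (m < n)%N by near: n; exact: nbhs_infty_gt.
    by rewrite (bigD1 (Ordinal mn))//= indicE mem_set// subrr mul0r subr0.
  apply: cvg_near_cst; apply: nearW => n.
  rewrite big1 ?subrr// => i _; rewrite indicE memNset ?subr0// => Fit.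
  by move/negP: tF'; apply; rewrite inE; exists i.
Unshelve. all: by end_near. Qed.

(** The polynomial cos (t - a/2) - cos (a/2) of degree one vanishes on the
    circle exactly at 0 and a, which makes every ray that starts on the
    circle the positivity set of a trigonometric polynomial. *)
Lemma lt_cos_half_angle (a t : R) : 0 <= a < 2 * pi -> circle t ->
  (a < t) = (cos (t - a / 2) < cos (a / 2)).
Proof.
move=> /andP[a0 a2] /andP[t0 t2]; have pi0 := @pi_gt0 R.
have ain : a / 2 \in `[0, pi] by rewrite in_itv /=; apply/andP; split; lra.
have [ta|ta] := lerP (a / 2) t; last first.
  rewrite -cosN opprB ltr_cos//; last first.
    by rewrite in_itv /=; apply/andP; split; lra.
  by apply/idP/idP => ?; lra.
have [tp|tp] := lerP (t - a / 2) pi.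
  rewrite ltr_cos//; last by rewrite in_itv /=; apply/andP; split; lra.
  by apply/idP/idP => ?; lra.
have -> : cos (t - a / 2) = cos (2 * pi - (t - a / 2)).
  by rewrite -[in RHS]cosN opprB -(cosD2pi (t - a / 2 - 2 * pi)); congr cos; lra.
rewrite ltr_cos//; last by rewrite in_itv /=; apply/andP; split; lra.
by apply/idP/idP => ?; lra.
Qed.

Lemma trig_limit_ray (a : R) : trig_limit_set `]a, +oo[%classic.
Proof.
rewrite /trig_limit_set.
have [a0|a0] := ltrP a 0.
  apply: trig_limit_eq (trig_limit_cst 1) _ => t /andP[t0 _].
  by rewrite indicE mem_set//= in_itv /= andbT (lt_le_trans a0).
have [a2|a2] := ltrP a (2 * pi); last first.
  apply: trig_limit_eq (trig_limit_cst 0) _ => t /andP[_ t2].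
  rewrite indicE memNset//= in_itv /= andbT => at_.
  by have := lt_trans (le_lt_trans a2 at_) t2; rewrite ltxx.
have lf : trig_limit (fun t => cos (a / 2) - cos (t - a / 2)).
  have t1 := trig_span_mono (character (- 1) (a / 2)) (I : [set: int] 1).
  have l1 := trig_limitZ (-1) (trig_limit_trig t1).
  apply: trig_limit_eq (trig_limitD (trig_limit_cst (cos (a / 2))) l1) _ => t _.
  rewrite mulN1r; congr (_ - _).
  by rewrite /character /= mulrNz mulr1z mulN1r !mul1r cosN sinN cosB; ring.
apply: trig_limit_eq (trig_limit_gt0 lf) _ => t ct.
rewrite subr_gt0 -lt_cos_half_angle ?a0// indicE; congr (_%:R).
by congr nat_of_bool; apply/idP/idP; rewrite inE /= in_itv /= andbT.
Qed.

(** Dynkin's lemma, applied to the rays, which form a pi-system generating the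
    Borel sets. *)
Lemma trig_limit_measurable_set (A : set T) : measurable A -> trig_limit_set A.
Proof.
move=> mA; have mA' : <<s @RGenOInfty.G R >> A.
  by move: mA; rewrite /= RGenOInfty.measurableE.
apply: (@dynkin_induction _ T (@RGenOInfty.G R) trig_limit_set _ _ _ _ _ _ A mA').
- exact: RGenOInfty.measurableE.
- move=> _ _ [a ->] [b ->]; exists (Num.max a b).
  by apply/seteqP; split => t /=; rewrite !in_itv /= !andbT gt_max;
    [move=> [-> ->]|move=> /andP].
- apply: trig_limit_eq (trig_limit_cst 1) _ => t _; by rewrite indicE mem_set.
- by move=> _ [a ->]; exact: trig_limit_ray.
- by move=> S _; exact: trig_limit_setC.
- by move=> F _ _; exact: trig_limit_bigcup.
Qed.

Import HBNNSimple.

(** Simple functions reach a nonnegative function from below; adding the bound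
    C first makes f nonnegative. *)
Lemma bm_trig_limit (f : R -> R) : bounded_measurable f -> trig_limit f.
Proof.
move=> [mf [C fC]].
have C0 : 0 <= C.
  have := fC 0; rewrite /circle /= lexx twopi_gt0 => /(_ isT).
  exact: le_trans.
pose g (t : T) := (f t + C)%:E.
have mg : measurable_fun circle g.
  apply/measurable_EFinP; apply: measurable_funD => //; exact: measurable_cst.
have g0 t : circle t -> (0 <= g t)%E.
  move=> ct; have := fC t ct; rewrite ler_norml lee_fin => /andP[? _]; lra.
pose h := nnsfun_approx measurable_circle mg.
have lh n : trig_limit (h n).
  rewrite (_ : (h n : R -> R) = fun t =>
      \sum_(y <- finmap.enum_fset (fset_set (range (h n))))
        y * \1_(h n @^-1` [set y]) t).
    apply: trig_limit_sum => y; apply: trig_limitZ.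
    apply: trig_limit_measurable_set; exact: measurable_sfunP.
  apply/funext => t; rewrite [LHS](fimfunE (h n)) fsbig_finite//.
have hle n t : circle t -> h n t <= f t + C.
  move=> ct; rewrite -lee_fin; have := le_approx n g0 ct.
  by rewrite -(nnsfun_approxE measurable_circle mg).
have lfC : trig_limit (fun t => f t + C).
  apply: (@trig_limit_lim _ (fun n t => h n t) _ (C + C)) => // [n t ct|t ct].
    rewrite ger0_norm; last exact: fun_ge0.
    rewrite (le_trans (hle n t ct))// lerD2r.
    by rewrite (le_trans (ler_norm _))// fC.
  by have := cvg_nnsfun_approx measurable_circle mg g0 ct => /fine_cvg.
by apply: trig_limit_eq (trig_limitD lfC (trig_limit_cst (- C))) _ => t _; rewrite addrK.
Qed.

End bounded_borel_functions.

(** * Means of trigonometric polynomials *)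

Section mean_trig.
Context {R : realType}.
Local Notation T := (measurableTypeR R).
Local Notation circle := (@circle R).

Lemma mean_derive (f F : R -> R) :
  bounded_measurable f -> continuous f ->
  (forall t : R, is_derive t (1 : R) F (f t)) -> F (2 * pi) = F 0 -> mean f = 0.
Proof.
move=> bf cf dF F0; rewrite /mean circle_itv Rintegral_itv_bndo_bndc; last first.
  by rewrite -circle_itv; exact: integrable_leb.
have cF : continuous F.
  move=> t; apply: differentiable_continuous; apply/derivable1_diffP.
  by have [] := dF t.
rewrite /Rintegral (@continuous_FTC2 _ f F 0 (2 * pi)) ?twopi_gt0//.
- by rewrite F0 subee//= mulr0.
- exact: continuous_subspaceT.
- split.
  + by move=> t _; have [] := dF t.
  + by apply: cvg_at_right_filter; exact: cF.
  + by apply: cvg_at_left_filter; exact: cF.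
- by move=> t _; rewrite derive1E; have [_ ->] := dF t.
Qed.

Lemma cos_sin_mul_2pi (n : nat) :
  cos (n%:R * (2 * pi)) = 1 :> R /\ sin (n%:R * (2 * pi)) = 0 :> R.
Proof.
elim: n => [|n [IHc IHs]]; first by rewrite mul0r cos0 sin0.
rewrite -natr1 mulrDl mul1r cosD sinD IHc IHs mulr_natl.
by rewrite cos2pi sin2pi !mul1r !mul0r subr0 addr0.
Qed.

Lemma mean_character (n : nat) : (0 < n)%N ->
  mean (fun t : R => cos (n%:R * t)) = 0 /\
  mean (fun t : R => sin (n%:R * t)) = 0.
Proof.
move=> n0; have n0' : n%:R != 0 :> R by rewrite pnatr_eq0 -lt0n.
have [c2 s2] := cos_sin_mul_2pi n.
have cmul : continuous (fun t : R => n%:R * t) by exact: mulrl_continuous.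
have cc : continuous (fun t : R => cos (n%:R * t)).
  by move=> t; apply: continuous_comp; [exact: cmul|exact: continuous_cos].
have cs : continuous (fun t : R => sin (n%:R * t)).
  by move=> t; apply: continuous_comp; [exact: cmul|exact: continuous_sin].
split.
- apply: (@mean_derive _ (fun t => n%:R^-1 * sin (n%:R * t))) => //.
  + split; last by exists 1 => t _; rewrite ler_norml cos_geN1 cos_le1.
    exact: (@measurable_funTS _ _ T R circle _ (continuous_measurable_fun cc)).
  + move=> t; apply: is_derive_eq.
    by rewrite /GRing.scale /=; field.
  + by rewrite s2 mulr0 mulr0 sin0 mulr0.
- apply: (@mean_derive _ (fun t => - n%:R^-1 * cos (n%:R * t))) => //.
  + split; last by exists 1 => t _; rewrite ler_norml sin_geN1 sin_le1.
    exact: (@measurable_funTS _ _ T R circle _ (continuous_measurable_fun cs)).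
  + move=> t; apply: is_derive_eq.
    by rewrite /GRing.scale /=; field.
  + by rewrite c2 mulr0 cos0.
Qed.

Lemma mean_trig_span (tau : R -> R[i]) : trig_span S1 tau ->
  mean (fun t => complex.Re (tau t)) = 0.
Proof.
apply: (@trig_span_ind R S1 (fun f => mean (fun t => complex.Re (f t)) = 0)).
  exact: mean_cst.
move=> x c f Sx Sf IH.
have [b1 b2] : bounded_measurable (fun t : R => complex.Re (c * character x t)) /\
    bounded_measurable (fun t => complex.Re (f t)).
  split; last exact: trig_span_bm Sf.
  exact: trig_span_bm (trig_span_mono c Sx).
under [X in mean X]eq_fun do rewrite Re_addc.
rewrite meanD// IH addr0.
case: x Sx b1 => [n|//]; rewrite /S1 /= => n0 _.
have [mc ms] := mean_character n0.
have bchar (a : R) :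
    bounded_measurable (fun t : R => complex.Re (a%:C%C * character n t)) /\
    bounded_measurable (fun t : R => complex.Re ((a *i)%C * character n t)).
  by split; apply: trig_span_bm (trig_span_mono _ (I : [set: int] n)).
have bc : bounded_measurable (fun t : R => cos (n%:R * t)).
  by apply: bm_eq (bchar 1).1 _ => t _ /=; rewrite mul1r mul0r subr0.
have bs : bounded_measurable (fun t : R => sin (n%:R * t)).
  by apply: bm_eq (bchar (- 1)).2 _ => t _ /=; rewrite mul0r sub0r mulN1r opprK.
under [X in mean X]eq_fun do rewrite Re_mulc /= -mulNr.
by rewrite meanD ?meanZ ?mc ?ms ?mulr0 ?addr0//; exact: bmZ.
Qed.

(** A real trigonometric polynomial is the real part of one without negative
    frequencies: a negative frequency is conjugated. *)
Lemma trig_span_analytic (tau : R -> R[i]) : trig_span [set: int] tau ->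
  exists c sigma, trig_span S1 sigma /\
    forall t, complex.Re (tau t) = c + complex.Re (sigma t).
Proof.
apply: (@trig_span_ind R setT (fun f => exists c sigma, trig_span S1 sigma /\
  forall t, complex.Re (f t) = c + complex.Re (sigma t))).
  by exists 0, (fun=> 0); split; [exact: trig_span0|move=> t; rewrite addr0].
move=> x d f _ _ [c [sigma [Ss fE]]]; case: x => [[|n]|n].
- exists (complex.Re d + c), sigma; split=> // t.
  by rewrite character0 mulr1 Re_addc fE addrA.
- exists c, (fun t => d * character n.+1 t + sigma t); split.
    by apply: trig_spanD => //; exact: trig_span_mono.
  by move=> t; rewrite !Re_addc fE addrCA.
- exists c, (fun t => d^*%C * character n.+1 t + sigma t); split.
    by apply: trig_spanD => //; exact: trig_span_mono.
  move=> t; rewrite !Re_addc fE addrCA; congr (_ + (_ + _)).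
  rewrite NegzE characterN; case: d (character _ _) => [a b] [a' b'] /=; ring.
Qed.

End mean_trig.

(** * Szego's inequality *)

Section szego.
Context {R : realType}.
Local Notation T := (measurableTypeR R).
Local Notation circle := (@circle R).

Lemma measurable_cmod_powR (D : set T) (f : R -> R[i]) (p : R) :
  measurable_fun D (fun t => complex.Re (f t)) ->
  measurable_fun D (fun t => complex.Im (f t)) ->
  measurable_fun D (fun t => cmod (f t) `^ p).
Proof.
move=> mR mI; apply: (@measurableT_comp _ _ _ _ _ _ (fun x => x `^ p)).
  exact: measurable_powR.
under eq_fun do rewrite cmodE.
apply: (@measurableT_comp _ _ _ T R R (Num.sqrt : R -> R)).
  apply: continuous_measurable_fun; exact: sqrt_continuous.
by apply: measurable_funD; exact: measurable_funX.
Qed.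

Lemma trig_span_bm_powR S (tau : R -> R[i]) (p : R) : 0 <= p ->
  trig_span S tau -> bounded_measurable (fun t => cmod (1 - tau t) `^ p).
Proof.
move=> p0 St; have Nt := trig_spanZ (-1) St.
have [C C0 tC] := trig_span_bounded Nt.
have [mR mI] := trig_span_measurable Nt.
split.
  apply: measurable_cmod_powR.
    under eq_fun do rewrite Re_addc -mulN1r.
    apply: measurable_funD; first exact: measurable_cst.
    exact: (@measurable_funTS _ _ T R circle _ mR).
  under eq_fun do rewrite Im_addc -mulN1r.
  apply: measurable_funD; first exact: measurable_cst.
  exact: (@measurable_funTS _ _ T R circle _ mI).
exists ((1 + C) `^ p) => t _; rewrite ger0_norm ?powR_ge0//.
rewrite ge0_ler_powR// ?nnegrE ?cmod_ge0 ?addr_ge0//.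
by rewrite (le_trans (ler_cmodD _ _))// cmod1 lerD2l -mulN1r.
Qed.

(** This is 1 + x <= exp x for x = 2 Re z + |z|^2, since |1 + z|^2 = 1 + x. *)
Lemma cmod_1D_le_expR (z : R[i]) :
  cmod (1 + z) <= expR (complex.Re z + cmod z ^+ 2 / 2).
Proof.
rewrite -ler_sqr ?nnegrE ?cmod_ge0 ?expR_ge0// !cmodE !sqr_sqrtr ?addr_ge0 ?sqr_ge0//.
rewrite -expRM_natl; apply: le_trans (expR_ge1Dx _).
by case: z => x y /=; rewrite le_eqVlt; apply/orP; left; apply/eqP; field.
Qed.

(** S1 is closed under addition, so the polynomials with constant term 1 and
    otherwise positive frequencies are closed under products. *)
Lemma one_sub_spanM (f g : R -> R[i]) : trig_span S1 f -> trig_span S1 g ->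
  exists2 h, trig_span S1 h & forall t, 1 - h t = (1 - f t) * (1 - g t).
Proof.
move=> Sf Sg.
have S1D x y : S1 x -> S1 y -> S1 (x + y).
  by rewrite /S1 /= => x1 y1; rewrite (le_trans x1)// lerDl (le_trans _ y1).
exists (fun t => f t + g t + (-1) * (f t * g t)).
  apply: trig_spanD; first exact: trig_spanD.
  exact/trig_spanZ/trig_spanM.
by move=> t; ring.
Qed.

Lemma one_add_spanX (f : R -> R[i]) n : trig_span S1 f ->
  exists2 h, trig_span S1 h & forall t, 1 - h t = (1 + f t) ^+ n.
Proof.
move=> Sf; elim: n => [|n [h Sh hE]].
  by exists (fun=> 0); [exact: trig_span0|move=> t; rewrite subr0 expr0].
have [k Sk kE] := one_sub_spanM (trig_spanZ (-1) Sf) Sh.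
exists k => // t; rewrite kE hE exprS; ring.
Qed.

Lemma le_of_expR_harmonic (D x y : R) :
  (forall n, x <= expR (D * harmonic n) * y) -> x <= y.
Proof.
move=> xy.
have lim : (expR (D * harmonic n) * y) @[n --> \oo] --> expR (D * 0) * y.
  apply: cvgM; last exact: cvg_cst.
  apply: (@continuous_cvg _ _ _ _ _ _ (expR : R -> R)); first exact: continuous_expR.
  by apply: cvgM; [exact: cvg_cst|exact: cvg_harmonic].
rewrite mulr0 expR0 mul1r in lim.
rewrite -(cvg_lim _ lim)//; apply: limr_ge.
  by apply/cvg_ex; eexists; exact: lim.
exact: nearW.
Qed.

Variables (rho : {measure set T -> \bar R}) (W : R -> R) (c p : R).
Hypothesis iW : rho.-integrable circle (EFin \o W).
Hypothesis W0 : forall t, circle t -> 0 <= W t.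
Hypothesis p0 : 0 < p.

Section lower_bound.
Hypothesis cW : forall tau, trig_span S1 tau ->
  c <= \int[rho]_(t in circle) (cmod (1 - tau t) `^ p * W t).

(** The test polynomials (1 + sigma/(pN))^N imitate the outer function exp
    (sigma / p), whose modulus to the power p is exp (Re sigma). Only the
    upper bound for that modulus matters, so no complex exponential enters. *)
Lemma szego_trig (sigma : R -> R[i]) : trig_span S1 sigma ->
  c <= \int[rho]_(t in circle) (expR (complex.Re (sigma t)) * W t).
Proof.
move=> Ss; have [C C0 sC] := trig_span_bounded Ss.
have bmE : bounded_measurable (fun t => expR (complex.Re (sigma t))).
  exact/bm_expR/trig_span_bm/Ss.
set I := \int[rho]_(t in circle) _.
pose D := C ^+ 2 / (2 * p).
have cN n : c <= expR (D * harmonic n) * I.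
  have N0 : 0 < n.+1%:R :> R by rewrite ltr0n.
  have pN0 : 0 < p * n.+1%:R by rewrite mulr_gt0.
  (* N = n + 1 keeps the denominator away from 0. *)
  pose z t := ((p * n.+1%:R)^-1)%:C%C * sigma t.
  have Sz : trig_span S1 z by exact: trig_spanZ.
  have [tau St tauE] := one_add_spanX n.+1 Sz.
  apply: le_trans (cW St) _.
  rewrite /I -RintegralZl//; last exact: integrable_bddM.
  apply: le_Rintegral => //.
  - apply: integrable_bddM => //; apply: trig_span_bm_powR St; exact: ltW.
  - under [X in _.-integrable _ X]eq_fun do rewrite /= mulrA.
    by apply: integrable_bddM => //; exact: bmZ.
  - move=> t ct; rewrite mulrA; apply: ler_wpM2r; first exact: W0.
    rewrite tauE cmodX -expRD.
    have h : cmod (1 + z t) ^+ n.+1 <=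
        expR ((complex.Re (z t) + cmod (z t) ^+ 2 / 2) * n.+1%:R).
      by rewrite expRM_natr lerXn2r ?nnegrE ?cmod_ge0 ?expR_ge0// cmod_1D_le_expR.
    have {h} h := @ge0_ler_powR R p (ltW p0) _ _ _ _ h.
    apply: le_trans (h _ _) _; rewrite ?nnegrE ?exprn_ge0 ?cmod_ge0 ?expR_ge0//.
    rewrite -expRM ler_expR.
    have -> : complex.Re (z t) = (p * n.+1%:R)^-1 * complex.Re (sigma t).
      by rewrite /z; case: (sigma t) => a b /=; rewrite mul0r subr0.
    have -> : cmod (z t) = (p * n.+1%:R)^-1 * cmod (sigma t).
      rewrite /z cmodM; congr (_ * _).
      by rewrite cmodE /= expr0n addr0 sqrtr_sqr ger0_norm// invr_ge0 ltW.
    have s2 : cmod (sigma t) ^+ 2 <= C ^+ 2 by rewrite lerXn2r ?nnegrE ?cmod_ge0.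
    rewrite (_ : _ * p = complex.Re (sigma t) +
      cmod (sigma t) ^+ 2 * (2 * p * n.+1%:R)^-1); last first.
      by field; rewrite !gt_eqF.
    rewrite addrC lerD2r (_ : D * _ = C ^+ 2 * (2 * p * n.+1%:R)^-1); last first.
      by rewrite /D /=; field; rewrite !gt_eqF.
    by rewrite ler_wpM2r// invr_ge0 ltW// -mulrA mulr_gt0.
exact: le_of_expR_harmonic cN.
Qed.

(** Splitting off the constant coefficient, which is the mean, reduces
    trigonometric polynomials to the previous case; dominated convergence then
    propagates the inequality through bounded limits. *)
Lemma szego_inequality f : bounded_measurable f ->
  c * expR (mean f) <= \int[rho]_(t in circle) (expR (f t) * W t).
Proof.
move=> /bm_trig_limit; elim=> [tau ttau|u {}f C lu IH uC uf].
  have [k [sigma [Ss tE]]] := trig_span_analytic ttau.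
  under [X in mean X]eq_fun do rewrite tE.
  under [X in Rintegral _ _ X]eq_fun do rewrite tE expRD -mulrA.
  have bs := trig_span_bm Ss.
  rewrite meanD ?mean_cst ?mean_trig_span// ?addr0; last exact: bm_cst.
  rewrite RintegralZl//; last by apply: integrable_bddM => //; exact: bm_expR.
  by rewrite mulrC ler_wpM2l ?expR_ge0// szego_trig.
have [mf _] : bounded_measurable f by exact: trig_limit_bm (trig_limit_lim lu uC uf).
have mu n : measurable_fun circle (u n) by have [] := trig_limit_bm (lu n).
have cvg_mean : mean (u n) @[n --> \oo] --> mean f.
  apply: cvgM; first exact: cvg_cst.
  exact: (Rintegral_dominated mu mf (integrable_cst_leb C)).
have cvg_int : (\int[rho]_(t in circle) (expR (u n t) * W t))%R @[n --> \oo]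
    --> (\int[rho]_(t in circle) (expR (f t) * W t))%R.
  have mW : measurable_fun circle W by case/integrableP: iW => /measurable_EFinP.
  apply: (@Rintegral_dominated _ _ (fun n t => expR (u n t) * W t) _
    (fun t => expR C * W t)).
  - by move=> n; apply: measurable_funM => //; exact: measurableT_comp.
  - by apply: measurable_funM => //; exact: measurableT_comp.
  - by apply: integrable_bddM => //; exact: bm_cst.
  - move=> n t ct; rewrite normrM [`|W t|]ger0_norm ?W0// ger0_norm ?expR_ge0//.
    apply: ler_wpM2r; first exact: W0.
    by rewrite ler_expR (le_trans (ler_norm _))// uC.
  - move=> t ct; apply: cvgM; last exact: cvg_cst.
    apply: (@continuous_cvg _ _ _ _ _ _ (expR : R -> R)); last exact: uf.
    exact: continuous_expR.
apply: (ler_cvg_to _ cvg_int); last first.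
  by apply: nearW => n; exact: IH.
apply: cvgM; first exact: cvg_cst.
apply: (@continuous_cvg _ _ _ _ _ _ (expR : R -> R)); last exact: cvg_mean.
exact: continuous_expR.
Qed.

End lower_bound.

(** From exp y <= 1 / (1 - y). *)
Lemma expR_le_quadratic (y : R) : `|y| <= 2^-1 ->
  expR y <= 1 + y + 2 * y ^+ 2.
Proof.
rewrite ler_norml => /andP[y1 y2].
have h := expR_ge1Dx (- y).
have e0 := expR_gt0 y.
have : expR (- y) * expR y = 1 by rewrite -expRD addNr expR0.
set a := expR (- y) in h *; set b := expR y in e0 * => ab.
have : (1 - y) * b <= 1 by rewrite -[leRHS]ab ler_pM2r.
move=> b1; rewrite -(@ler_pM2l _ (1 - y)); last by lra.
apply: le_trans b1 _.
rewrite (_ : (1 - y) * (1 + y + 2 * y ^+ 2) = 1 + y ^+ 2 * (1 - 2 * y)); last by ring.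
by rewrite lerDl mulr_ge0 ?sqr_ge0//; lra.
Qed.

(** If W has integral exactly c, then s |-> int exp (s f) W - c exp (s mean f)
    is nonnegative and vanishes at s = 0, so its derivative int f W - c mean f
    is zero. In other words W rho = c lambda. *)
Lemma mean_eq_of_szego :
  c = \int[rho]_(t in circle) W t ->
  (forall f, bounded_measurable f ->
    c * expR (mean f) <= \int[rho]_(t in circle) (expR (f t) * W t)) ->
  forall f, bounded_measurable f ->
    \int[rho]_(t in circle) (f t * W t) = c * mean f.
Proof.
move=> cE szego.
have c0 : 0 <= c by rewrite cE; exact: Rintegral_ge0.
suff le f : bounded_measurable f ->
    c * mean f <= \int[rho]_(t in circle) (f t * W t).
  move=> f bf; apply: le_anti; rewrite le// andbT.
  have bNf := bmZ (-1) bf.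
  have := le _ bNf; rewrite meanZ//.
  under [X in Rintegral _ _ X]eq_fun do rewrite -mulrA.
  by rewrite RintegralZl ?integrable_bddM// mulN1r mulrN mulN1r lerN2.
move=> bf; have [mf [C' fC']] := bf.
pose C := `|C'| + 1.
have C1 : 0 < C by rewrite /C ltr_wpDl.
have fC t : circle t -> `|f t| <= C.
  by move=> /fC' /le_trans; apply; rewrite /C ler_wpDr// ler_norm.
set F := \int[rho]_(t in circle) _; set m := mean f.
have key s : 0 < s <= (2 * C)^-1 -> c * m <= F + 2 * s * C ^+ 2 * c.
  move=> /andP[s0 sC].
  have sC2 : s * C <= 2^-1.
    by move: sC; rewrite invfM -ler_pdivlMr ?invr_gt0// ?invrK.
  have := szego _ (bmZ s bf); rewrite meanZ// -/m => h1.
  have h2 : c * (1 + s * m) <= c * expR (s * m) by rewrite ler_wpM2l// expR_ge1Dx.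
  have h3 : \int[rho]_(t in circle) (expR (s * f t) * W t) <=
            \int[rho]_(t in circle) ((1 + s * f t + 2 * (s * C) ^+ 2) * W t).
    apply: le_Rintegral => //.
    - by apply: integrable_bddM => //; apply: bm_expR; exact: bmZ.
    - apply: integrable_bddM => //; apply: bmD; last exact: bm_cst.
      by apply: bmD; [exact: bm_cst|exact: bmZ].
    - move=> t ct; apply: ler_wpM2r; first exact: W0.
      have sf : `|s * f t| <= s * C by rewrite normrM gtr0_norm// ler_pM2l// fC.
      apply: le_trans (expR_le_quadratic (le_trans sf sC2)) _.
      rewrite lerD2l ler_pM2l// -real_normK ?num_real//.
      by rewrite lerXn2r ?nnegrE// ltW// mulr_gt0.
  have h4 : \int[rho]_(t in circle) ((1 + s * f t + 2 * (s * C) ^+ 2) * W t) =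
     c + s * F + 2 * (s * C) ^+ 2 * c.
    under [X in Rintegral _ _ X]eq_fun do rewrite mulrDl mulrDl mul1r -[s * _ * _]mulrA.
    have iF := integrable_bddM iW bf.
    have isF : rho.-integrable circle (EFin \o (fun t => s * (f t * W t))).
      under [X in _.-integrable _ X]eq_fun do rewrite /= mulrA.
      by apply: integrable_bddM => //; exact: bmZ.
    have iK : rho.-integrable circle (EFin \o (fun t => 2 * (s * C) ^+ 2 * W t)).
      by apply: integrable_bddM => //; exact: bm_cst.
    rewrite RintegralD//; last first.
      exact: (integrableD measurable_circle iW isF).
    rewrite RintegralD// RintegralZl// RintegralZl//.
    by rewrite -cE.
  rewrite h4 in h3.
  have : s * (c * m) <= s * (F + 2 * s * C ^+ 2 * c) by lra.
  by rewrite ler_pM2l.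
apply/ler_addgt0Pr => e e0.
(* The quadratic remainder is at most s K after division by s, and K + 1
   avoids dividing by zero. *)
pose K := 2 * C ^+ 2 * c.
have K0 : 0 <= K by rewrite !mulr_ge0// ltW.
pose s := Num.min (2 * C)^-1 (e / (K + 1)).
have s0 : 0 < s.
  by rewrite lt_min invr_gt0 mulr_gt0//= divr_gt0// ltr_wpDl.
have sin : 0 < s <= (2 * C)^-1 by rewrite s0 ge_min lexx.
apply: le_trans (key s sin) _.
rewrite lerD2l.
have sK : s <= e / (K + 1) by rewrite ge_min lexx orbT.
have : s * (K + 1) <= e by rewrite -ler_pdivlMr// ltr_wpDl.
by rewrite /K; lra.
Qed.

End szego.

(** * Prediction errors on the circle *)

Section prediction_error.
Context {R : realType}.
Local Notation T := (measurableTypeR R).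
Local Notation circle := (@circle R).
Variables (mu : {finite_measure set T -> \bar R}) (p : R).
Hypothesis mu_circle : mu (~` circle) = 0%E.
Hypothesis p0 : 0 < p.

Lemma EFin_Rintegral (rho : {measure set T -> \bar R}) (f : R -> R) :
  rho.-integrable circle (EFin \o f) ->
  (\int[rho]_(t in circle) f t)%:E = (\int[rho]_(t in circle) (f t)%:E)%E.
Proof. by move=> fi; rewrite /Rintegral fineK// integrable_fin_num. Qed.

(** A measure carried by the circle may be integrated over the circle alone,
    where bounded functions are handled uniformly with Lebesgue measure. *)
Lemma integral_circle (f : T -> \bar R) : measurable_fun [set: T] f ->
  (forall t, 0 <= f t)%E ->
  (\int[mu]_t f t = \int[mu]_(t in circle) f t)%E.
Proof.
move=> mf f0; rewrite (@ge0_negligible_integral _ _ _ mu setT (~` circle))//.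
  by rewrite setTD setCK.
exact: measurableC.
Qed.

Lemma measurable_cmod_one_sub (D : set T) (f : R -> R[i]) :
  measurable_fun D (fun t => complex.Re (f t)) ->
  measurable_fun D (fun t => complex.Im (f t)) ->
  measurable_fun D (fun t => cmod (1 - f t) `^ p).
Proof.
move=> mR mI; apply: measurable_cmod_powR.
  rewrite (_ : (fun _ => _) = fun t => 1 - complex.Re (f t)).
    by apply: measurable_funB => //; exact: measurable_cst.
  by apply/funext => t; case: (f t).
rewrite (_ : (fun _ => _) = fun t => 0 - complex.Im (f t)).
  by apply: measurable_funB => //; exact: measurable_cst.
by apply/funext => t; case: (f t).
Qed.

Lemma lp_error_circle (f : R -> R[i]) :
  measurable_fun [set: T] (fun t => complex.Re (f t)) ->
  measurable_fun [set: T] (fun t => complex.Im (f t)) ->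
  lp_error mu p f = (\int[mu]_(t in circle) (cmod (1 - f t) `^ p)%:E)%E.
Proof.
move=> mR mI; rewrite /lp_error integral_circle//.
  by apply/measurable_EFinP; exact: measurable_cmod_one_sub.
by move=> t; rewrite lee_fin powR_ge0.
Qed.

Lemma lp_error_ge0 (f : R -> R[i]) : (0 <= lp_error mu p f)%E.
Proof. by apply: integral_ge0 => t _; rewrite lee_fin powR_ge0. Qed.

Lemma lp_error_trig S (tau : R -> R[i]) : trig_span S tau ->
  lp_error mu p tau = (\int[mu]_(t in circle) (cmod (1 - tau t) `^ p))%:E.
Proof.
move=> St; have [mR mI] := trig_span_measurable St.
rewrite lp_error_circle// EFin_Rintegral//; apply: integrable_fin.
by apply: trig_span_bm_powR St; exact: ltW.
Qed.

Lemma d_ge0 : (0 <= d_ p mu S1)%E.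
Proof. by apply: le_ereal_inf_tmp => _ [f _ <-]; exact: lp_error_ge0. Qed.

Lemma d_fin_num : d_ p mu S1 \is a fin_num.
Proof.
rewrite ge0_fin_numE ?d_ge0//.
apply: (@le_lt_trans _ _ (lp_error mu p (fun=> 0))).
  by apply: ereal_inf_lbound; exists (fun=> 0) => //; exact: trig_span0.
by rewrite (lp_error_trig (trig_span0 S1)) ltry.
Qed.

Lemma d_le_trig tau : trig_span S1 tau ->
  fine (d_ p mu S1) <= \int[mu]_(t in circle) (cmod (1 - tau t) `^ p).
Proof.
move=> St; rewrite -lee_fin fineK ?d_fin_num// -(lp_error_trig St).
by apply: ereal_inf_lbound; exists tau.
Qed.

Lemma d_approx e : 0 < e -> exists2 tau, trig_span S1 tau &
  \int[mu]_(t in circle) (cmod (1 - tau t) `^ p) < fine (d_ p mu S1) + e.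
Proof.
move=> e0; have [_ [tau St <-]] := lb_ereal_inf_adherent e0 d_fin_num.
rewrite -/(d_ p mu S1) (lp_error_trig St) -(fineK d_fin_num) lte_fin.
by exists tau.
Qed.

End prediction_error.

(** * Minimality of the metric projection *)

Section projection.
Context {R : realType}.
Local Notation T := (measurableTypeR R).
Local Notation circle := (@circle R).
Local Notation leb := (@lebesgue_measure R).
Variables (nu : {finite_measure set T -> \bar R}) (p : R) (phi : R -> R[i]).
Hypothesis nu_circle : nu (~` circle) = 0%E.
Hypothesis p1 : 1 <= p.
Hypothesis phiP : metric_projection nu p S1 phi.

Local Notation d := (fine (d_ p nu S1)).
Local Notation V := (fun t => cmod (1 - phi t) `^ p).

Let p0 : 0 < p. Proof. exact: lt_le_trans p1. Qed.

Lemma projection_measurable_Re_Im :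
  measurable_fun [set: T] (fun t => complex.Re (phi t)) /\
  measurable_fun [set: T] (fun t => complex.Im (phi t)).
Proof. by have [[[? ? _] _] _] := phiP. Qed.

Lemma projection_measurable : measurable_fun circle V.
Proof.
have [mR mI] := projection_measurable_Re_Im.
by apply: measurable_funTS; exact: measurable_cmod_one_sub.
Qed.

Lemma projection_integral : (\int[nu]_(t in circle) (V t)%:E)%E = d%:E.
Proof.
have [mR mI] := projection_measurable_Re_Im.
by rewrite -lp_error_circle// fineK ?d_fin_num//; have [_] := phiP.
Qed.

Lemma projection_integrable : nu.-integrable circle (EFin \o V).
Proof.
apply/integrableP; split; first by apply/measurable_EFinP; exact: projection_measurable.
under eq_integral do rewrite /= ger0_norm ?powR_ge0//.
by rewrite projection_integral ltry.
Qed.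

Lemma projection_Rintegral : \int[nu]_(t in circle) V t = d.
Proof. by rewrite /Rintegral projection_integral. Qed.

(** Membership in the closure, restated with p-th powers of integrals in place
    of norms. *)
Lemma closure_approx e : 0 < e -> exists2 tau, trig_span S1 tau &
  nu.-integrable circle (EFin \o (fun t => cmod (phi t - tau t) `^ p)) /\
  \int[nu]_(t in circle) (cmod (phi t - tau t) `^ p) <= e.
Proof.
move=> e0; have [[_ close] _] := phiP.
have ep : 0 < e `^ p^-1 by rewrite powR_gt0.
have [tau St lt_e] := close _ ep; exists tau => //.
have [mR mI] := projection_measurable_Re_Im; have [mR' mI'] := trig_span_measurable St.
have mf : measurable_fun [set: T] (fun t => cmod (phi t - tau t) `^ p).
  apply: measurable_cmod_powR.
    rewrite (_ : (fun _ => _) = fun t => complex.Re (phi t) - complex.Re (tau t)).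
      exact: measurable_funB.
    by apply/funext => t; case: (phi t) (tau t) => [? ?] [? ?].
  rewrite (_ : (fun _ => _) = fun t => complex.Im (phi t) - complex.Im (tau t)).
    exact: measurable_funB.
  by apply/funext => t; case: (phi t) (tau t) => [? ?] [? ?].
have le_e : (\int[nu]_(t in circle) (cmod (phi t - tau t) `^ p)%:E <= e%:E)%E.
  rewrite -integral_circle//; last 2 first.
  - by apply/measurable_EFinP.
  - by move=> t; rewrite lee_fin powR_ge0.
  have := ltW lt_e; rewrite /complex_Lnorm => le_ep.
  have := @gt0_ler_poweR R p (ltW p0) _ _ _ _ le_ep.
  rewrite poweR_Lnorm ?gt_eqF// poweR_EFin -powRrM mulVf ?gt_eqF// powRr1 ?(ltW e0)//.
  rewrite !in_itv /= !leey !andbT Lnorm_ge0 lee_fin (ltW ep) => /(_ isT isT).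
  apply: le_trans; rewrite le_eqVlt; apply/orP; left; apply/eqP.
  apply: eq_integral => t _.
  by rewrite /= ger0_norm ?cmod_ge0.
suff ii : nu.-integrable circle (EFin \o (fun t => cmod (phi t - tau t) `^ p)).
  by split=> //; rewrite -lee_fin EFin_Rintegral.
apply/integrableP; split; first by apply/measurable_EFinP; exact: measurable_funTS.
under eq_integral do rewrite /= ger0_norm ?powR_ge0//.
by rewrite (le_lt_trans le_e) ?ltry.
Qed.


(** Either y <= dl x or x < dl^-1 y. The factor of x^p can be made as close to 1
    as desired, at the expense of the factor of y^p. *)
Lemma powRD_le (x y dl : R) : 0 <= x -> 0 <= y -> 0 < dl ->
  (x + y) `^ p <= (1 + dl) `^ p * x `^ p + (1 + dl^-1) `^ p * y `^ p.
Proof.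
move=> x0 y0 dl0; have dli : 0 < dl^-1 by rewrite invr_gt0.
rewrite -!powRM ?addr_ge0 ?(ltW dl0) ?(ltW dli)//.
have [yx|yx] := lerP y (dl * x).
  rewrite -[leLHS]addr0 lerD ?powR_ge0// ge0_ler_powR ?(ltW p0)// ?nnegrE; last by lra.
  - by rewrite addr_ge0.
  - by rewrite mulr_ge0// addr_ge0// ltW.
rewrite -[leLHS]add0r lerD ?powR_ge0// ge0_ler_powR ?(ltW p0)// ?nnegrE.
- by rewrite addr_ge0.
- by rewrite mulr_ge0// addr_ge0// ltW.
- by rewrite mulrDl mul1r addrC lerD2l ler_pdivlMl// ltW.
Qed.

(** If tau_n in T(S1) tends to phi then (1 - tau)(1 - tau_n) is a competitor
    in the infimum d, and it tends to (1 - tau)(1 - phi) in L^p(nu) because 1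
    - tau is bounded. *)
Lemma projection_minimal (tau : R -> R[i]) : trig_span S1 tau ->
  d <= \int[nu]_(t in circle) (cmod (1 - tau t) `^ p * V t).
Proof.
move=> St; set I := (X in _ <= X).
have bQ := trig_span_bm_powR (ltW p0) St.
have iQV := integrable_bddM projection_integrable bQ.
apply: (@le_of_expR_harmonic _ p) => n.
(* The factor (1 + dl)^p tends to 1 with dl, through (1 + dl)^p <= exp (p dl).
   *)
pose dl : R := harmonic n; have dl0 : 0 < dl by exact: harmonic_gt0.
apply: (@le_trans _ _ ((1 + dl) `^ p * I)); last first.
  apply: ler_wpM2r.
    by apply: Rintegral_ge0 => t ct; rewrite mulr_ge0 ?powR_ge0.
  rewrite mulrC expRM; apply: ge0_ler_powR; rewrite ?nnegrE ?expR_ge0 ?(ltW p0)//.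
    by rewrite addr_ge0// ltW.
  exact: expR_ge1Dx.
apply/ler_addgt0Pr => e e0.
have [_ [C QC]] := bQ.
pose K := (1 + dl^-1) `^ p * `|C|.
have K0 : 0 <= K by rewrite mulr_ge0 ?powR_ge0.
have [sigma Ss [iS leS]] : exists2 sigma, trig_span S1 sigma &
  nu.-integrable circle (EFin \o (fun t => cmod (phi t - sigma t) `^ p)) /\
  \int[nu]_(t in circle) (cmod (phi t - sigma t) `^ p) <= e / (K + 1).
  by apply: closure_approx; rewrite divr_gt0// ltr_wpDl.
have [h Sh hE] := one_sub_spanM St Ss.
apply: le_trans (d_le_trig nu_circle p0 Sh) _.
have i1 : nu.-integrable circle
    (EFin \o (fun t => (1 + dl) `^ p * (cmod (1 - tau t) `^ p * V t))).
  under [X in _.-integrable _ X]eq_fun do rewrite /= mulrA.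
  by apply: integrable_bddM projection_integrable _; exact: bmZ.
have i2 : nu.-integrable circle (EFin \o (fun t => K * cmod (phi t - sigma t) `^ p)).
  by apply: integrable_bddM iS _; exact: bm_cst.
have le1 : \int[nu]_(t in circle) (cmod (1 - h t) `^ p) <=
    \int[nu]_(t in circle) ((1 + dl) `^ p * (cmod (1 - tau t) `^ p * V t) +
      K * cmod (phi t - sigma t) `^ p).
  apply: le_Rintegral => //.
  - by apply: integrable_fin; exact: trig_span_bm_powR (ltW p0) Sh.
  - exact: (integrableD measurable_circle i1 i2).
  - move=> t ct; rewrite hE cmodM.
    have tri : cmod (1 - sigma t) <= cmod (1 - phi t) + cmod (phi t - sigma t).
      by apply: le_trans (ler_cmodD _ _); rewrite addrA subrK.
    rewrite powRM ?cmod_ge0// /K -mulrA.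
    have h1 : cmod (1 - sigma t) `^ p <=
        (1 + dl) `^ p * V t + (1 + dl^-1) `^ p * cmod (phi t - sigma t) `^ p.
      apply: le_trans (powRD_le _ _ dl0); rewrite ?cmod_ge0//.
      by rewrite ge0_ler_powR ?(ltW p0)// ?nnegrE ?cmod_ge0// addr_ge0 ?cmod_ge0.
    have h2 : 0 <= cmod (1 - tau t) `^ p by exact: powR_ge0.
    apply: le_trans (ler_wpM2l h2 h1) _; rewrite mulrDr lerD//.
      by rewrite mulrCA.
    rewrite mulrCA ler_wpM2l ?powR_ge0// ler_wpM2r ?powR_ge0//.
    by apply: le_trans (ler_norm _); apply: le_trans (QC t ct); exact: ler_norm.
apply: le_trans le1 _.
rewrite RintegralD// RintegralZl// RintegralZl// lerD2l.
apply: le_trans (ler_wpM2l K0 leS) _.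
rewrite mulrCA ger_pMr// ler_pdivrMr ?mul1r ?lerDl// ltr_wpDl//.
Qed.

End projection.

(** * Polynomial weights for Lebesgue measure *)

Section lebesgue_lower_bound.
Context {R : realType}.
Local Notation T := (measurableTypeR R).
Local Notation circle := (@circle R).
Local Notation leb := (@lebesgue_measure R).

(** Bernoulli's inequality, obtained from Young's inequality for the pair (x,
    1). *)
Lemma powR_ge_tangent (p x : R) : 1 <= p -> 0 <= x -> 1 + p * (x - 1) <= x `^ p.
Proof.
move=> p1 x0; have p0 : 0 < p by exact: lt_le_trans p1.
have [->|pn1] := eqVneq p 1; first by rewrite powRr1//; lra.
have p1' : 1 < p by rewrite lt_neqAle eq_sym pn1.
have q0 : 0 < (1 - p^-1)^-1 by rewrite invr_gt0 subr_gt0 invf_lt1.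
have := @conjugate_powR _ x 1 p (1 - p^-1)^-1 x0 ler01 p0 q0.
rewrite invrK addrC subrK => /(_ erefl); rewrite mulr1 powR1 mul1r => h.
have : p * x <= p * (x `^ p / p + (1 - p^-1)) by rewrite ler_pM2l.
by rewrite mulrDr mulrCA divff ?gt_eqF// mulr1 mulrBr divff ?gt_eqF//; lra.
Qed.

(** The mean of Re (1 - tau) is 1; Bernoulli's inequality passes from this to
    the power p. *)
Lemma mean_powR_ge1 (p : R) (tau : R -> R[i]) : 1 <= p -> trig_span S1 tau ->
  1 <= mean (fun t => cmod (1 - tau t) `^ p).
Proof.
move=> p1 St; have p0 : 0 <= p by exact: le_trans p1.
have bt := trig_span_bm St.
have b1 : bounded_measurable (fun t => 1 + (- p) * complex.Re (tau t)).
  by apply: bmD; [exact: bm_cst|exact: bmZ].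
have -> : 1 = mean (fun t => 1 + (- p) * complex.Re (tau t)).
  rewrite meanD ?mean_cst ?meanZ// ?(mean_trig_span St) ?mulr0 ?addr0//.
  - exact: bm_cst.
  - exact: bmZ.
apply: le_mean => //; first exact: trig_span_bm_powR St.
move=> t _; apply: le_trans (powR_ge_tangent p1 (cmod_ge0 _)).
rewrite lerD2l mulNr -mulrN ler_wpM2l//.
have := ler_norm (complex.Re (1 - tau t)).
have := ler_Re_cmod (1 - tau t).
have -> : complex.Re (1 - tau t) = 1 - complex.Re (tau t) by case: (tau t).
lra.
Qed.

Lemma RintegralE_mean (f : R -> R) :
  \int[leb]_(t in circle) f t = (2 * pi) * mean f.
Proof. by rewrite /mean mulrA divff ?mul1r// gt_eqF// twopi_gt0. Qed.

(** Szego's inequality for the weight |Q|^p with Q = 1 - tau: products of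
    polynomials 1 - sigma stay of that form, so the lower bound 1 holds for all
    of them. *)
Lemma szego_polynomial_weight (p : R) (tau : R -> R[i]) (f : R -> R) : 1 <= p ->
  trig_span S1 tau -> bounded_measurable f ->
  expR (mean f) <= mean (fun t => expR (f t) * cmod (1 - tau t) `^ p).
Proof.
move=> p1 St bf; have p0 : 0 < p by exact: lt_le_trans p1.
have bQ := trig_span_bm_powR (ltW p0) St.
have := @szego_inequality R leb (fun t => cmod (1 - tau t) `^ p) (2 * pi) p
  (integrable_leb bQ) (fun t _ => powR_ge0 _ _) p0 _ f bf.
rewrite RintegralE_mean ler_pM2l ?twopi_gt0//; apply=> sigma Ss.
have [h Sh hE] := one_sub_spanM Ss St.
rewrite RintegralE_mean ler_peMr ?(ltW twopi_gt0)//.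
under [X in mean X]eq_fun do rewrite -powRM ?cmod_ge0// -cmodM -hE.
exact: mean_powR_ge1.
Qed.

End lebesgue_lower_bound.

(** * The weight of the metric projection *)

Section projection_weight.
Context {R : realType}.
Local Notation T := (measurableTypeR R).
Local Notation circle := (@circle R).
Local Notation leb := (@lebesgue_measure R).
Variables (nu : {finite_measure set T -> \bar R}) (p : R) (phi : R -> R[i]).
Hypothesis nu_circle : nu (~` circle) = 0%E.
Hypothesis p1 : 1 <= p.
Hypothesis phiP : metric_projection nu p S1 phi.

Local Notation d := (fine (d_ p nu S1)).
Local Notation V := (fun t => cmod (1 - phi t) `^ p).

Let p0 : 0 < p. Proof. exact: lt_le_trans p1. Qed.
Let V0 t : circle t -> 0 <= V t. Proof. by move=> _; exact: powR_ge0. Qed.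
Let iV := projection_integrable nu_circle p1 phiP.
Let mV := projection_measurable phiP.

(** The weight of the metric projection turns nu into a multiple of Lebesgue
    measure: its total mass is d, and by minimality no polynomial factor can
    make it smaller. *)
Lemma projection_mean (f : R -> R) : bounded_measurable f ->
  \int[nu]_(t in circle) (f t * V t) = d * mean f.
Proof.
apply: (mean_eq_of_szego iV V0) => [|g bg].
  by rewrite (projection_Rintegral nu_circle p1 phiP).
apply: (szego_inequality iV V0 p0) => // tau St.
exact: projection_minimal.
Qed.

Definition clamp (a b x : R) : R := Num.max a (Num.min b x).

Lemma clamp_gt0 a b x : 0 < a -> 0 < clamp a b x.
Proof. by move=> a0; rewrite lt_max a0. Qed.

Lemma bm_ln_clamp a b : 0 < a -> a <= b ->
  bounded_measurable (fun t => ln (clamp a b (V t))).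
Proof.
move=> a0 ab; have b0 := lt_le_trans a0 ab; split.
  apply: (@measurableT_comp _ _ _ T R R (@ln R)); first exact: measurable_ln.
  apply: measurable_maxr; first exact: measurable_cst.
  by apply: measurable_minr => //; exact: measurable_cst.
exists (`|ln a| + `|ln b|) => t _.
have c0 := clamp_gt0 b (V t) a0.
have h1 : ln a <= ln (clamp a b (V t)) by rewrite ler_ln ?posrE// le_max lexx.
have h2 : ln (clamp a b (V t)) <= ln b.
  by rewrite ler_ln ?posrE// ge_max ab ge_min lexx.
have := ler_norm (ln b); have := ler_norm (- ln a); rewrite normrN.
have := normr_ge0 (ln a); have := normr_ge0 (ln b).
by rewrite ler_norml => ? ? ? ?; apply/andP; split; lra.
Qed.

Lemma invr_clamp_le a b x : 0 < a -> a <= b ->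
  (clamp a b x)^-1 <= (Num.max a x)^-1 + b^-1.
Proof.
move=> a0 ab; have b0 := lt_le_trans a0 ab; rewrite /clamp.
have m0 : 0 < Num.max a x by rewrite lt_max a0.
have [bx|xb] := lerP b x.
  by rewrite max_r// lerDr invr_ge0 ltW.
by rewrite lerDl invr_ge0 ltW.
Qed.

(** The mean of log V is nonnegative: Szego's inequality for the weight |Q|^p
    and the exponent - log V bounds exp (- mean (log V)) by the integral of
    |Q|^p / V against Lebesgue measure, which is the integral of |Q|^p against
    nu divided by d, and Q may be chosen to make this close to 1. The upper
    truncation level b is chosen after Q. *)
Lemma log_mean_clamp a eta : 0 < d -> 0 < a -> 0 < eta ->
  exists2 b, a <= b & - eta <= mean (fun t => ln (clamp a b (V t))).
Proof.
move=> d0 a0 eta0.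
have de0 : 0 < d * (eta / 2) by rewrite mulr_gt0// divr_gt0.
have [tau St tauE] := d_approx nu_circle p0 de0.
have bQ := trig_span_bm_powR (ltW p0) St.
set Q := fun t => cmod (1 - tau t) `^ p in bQ tauE *.
have Q0 t : 0 <= Q t by exact: powR_ge0.
(* Levels above 2 mean Q / eta make the truncation error mean Q / b at most
   eta / 2. *)
pose b := Num.max a (mean Q * 2 / eta).
have ab : a <= b by rewrite le_max lexx.
have b0 := lt_le_trans a0 ab.
exists b => //; set k := fun t => ln (clamp a b (V t)).
have bk : bounded_measurable k by exact: bm_ln_clamp.
have bNk := bmZ (-1) bk.
have := szego_polynomial_weight p1 St bNk; rewrite -/Q meanZ// mulN1r => szego.
have bM := bm_invr_max a0 mV.
have bQM := bmM bQ bM.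
have le1 : expR (- mean k) <=
    mean (fun t => Q t * (Num.max a (V t))^-1 + b^-1 * Q t).
  apply: le_trans szego _; apply: le_mean.
  - by apply: bmM => //; exact: bm_expR.
  - by apply: bmD => //; exact: bmZ.
  - move=> t ct; rewrite mulN1r expRN lnK ?posrE ?clamp_gt0// mulrC.
    rewrite [b^-1 * _]mulrC -mulrDr ler_wpM2l ?powR_ge0 //; exact: invr_clamp_le.
have le2 : d * mean (fun t => Q t * (Num.max a (V t))^-1) <= d * (1 + eta / 2).
  rewrite -projection_mean//.
  apply: (@le_trans _ _ (\int[nu]_(t in circle) Q t)).
    apply: le_Rintegral => //.
    - exact: integrable_bddM.
    - exact: integrable_fin.
    - move=> t ct; rewrite -mulrA ler_piMr// mulrC ler_pdivrMr ?lt_max ?a0//.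
      by rewrite mul1r le_max lexx orbT.
  by rewrite mulrDr mulr1 ltW.
rewrite ler_pM2l// in le2.
have le3 : b^-1 * mean Q <= eta / 2.
  rewrite mulrC ler_pdivrMr// mulrC -ler_pdivrMr ?divr_gt0//.
  by rewrite invf_div mulrA le_max lexx orbT.
have {le1} : expR (- mean k) <= 1 + eta.
  apply: le_trans le1 _; rewrite meanD// ?meanZ//; last exact: bmZ.
  by apply: le_trans (lerD le2 le3) _; rewrite -addrA -splitr.
move=> /le_trans /(_ (expR_ge1Dx eta)); rewrite ler_expR; lra.
Qed.

(** Szego's inequality for mu with weight 1 and exponent f + log V: as log V has
    nonnegative mean, it can be dropped on the left, while exp (log V) = V. The
    lower truncation level a adds at most a int exp(f) dmu on the right. *)
Lemma error_lower_bound (mu : {finite_measure set T -> \bar R}) (f : R -> R) :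
  mu (~` circle) = 0%E -> 0 < d ->
  mu.-integrable circle (EFin \o V) -> bounded_measurable f ->
  fine (d_ p mu S1) * expR (mean f) <=
    \int[mu]_(t in circle) (expR (f t) * V t).
Proof.
move=> mu_circle d0 iVmu bf; set D := fine _.
have i1 : mu.-integrable circle (EFin \o cst 1) by apply: integrable_fin; exact: bm_cst.
have bef := bm_expR bf.
have ief := integrable_fin mu bef.
have iefV := integrable_bddM iVmu bef.
have szego k : bounded_measurable k ->
    D * expR (mean k) <= \int[mu]_(t in circle) expR (k t).
  move=> bk; under [X in Rintegral _ _ X]eq_fun do rewrite -[expR _]mulr1.
  apply: (szego_inequality i1 _ p0) => // tau St.
  by under [X in Rintegral _ _ X]eq_fun do rewrite mulr1; exact: d_le_trig.
set J := \int[mu]_(t in circle) (expR (f t) * V t).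
set E := \int[mu]_(t in circle) expR (f t).
have E0 : 0 <= E by apply: Rintegral_ge0 => t _; exact: expR_ge0.
have J0 : 0 <= J by apply: Rintegral_ge0 => t _; rewrite mulr_ge0 ?expR_ge0 ?powR_ge0.
have key a : 0 < a -> D * expR (mean f) <= J + a * E.
  move=> a0; apply: (@le_of_expR_harmonic _ 1) => n; rewrite mul1r.
  have n0 : 0 < harmonic n :> R by exact: harmonic_gt0.
  have [b ab leb_] := log_mean_clamp d0 a0 n0.
  have bk := bm_ln_clamp a0 ab; set k := fun t => ln _ in bk leb_.
  have := szego _ (bmD bf bk); rewrite meanD// expRD => h1.
  have h2 : \int[mu]_(t in circle) expR (f t + k t) <= J + a * E.
    rewrite /J /E -RintegralZl// -RintegralD//; last first.
      by under [X in _.-integrable _ X]eq_fun do rewrite /=;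
        exact: integrable_fin (bmZ a bef).
    apply: le_Rintegral => //.
    - by apply: integrable_fin; exact/bm_expR/bmD.
    - exact: (integrableD measurable_circle iefV (integrable_fin mu (bmZ a bef))).
    - move=> t ct; rewrite expRD lnK ?posrE ?clamp_gt0// [a * _]mulrC -mulrDr.
      rewrite ler_wpM2l ?expR_ge0// /clamp ge_max lerDr powR_ge0/=.
      by rewrite ge_min lerDl (ltW a0) orbT.
  have h3 := le_trans h1 h2.
  have D0 : 0 <= D by rewrite fine_ge0// d_ge0.
  have e1 : 1 <= expR (harmonic n) * expR (mean k).
    by rewrite -expRD -expR0 ler_expR; lra.
  apply: (@le_trans _ _ (expR (harmonic n) * (D * (expR (mean f) * expR (mean k))))).
    rewrite (_ : _ * (D * _) = (D * expR (mean f)) * (expR (harmonic n) * expR (mean k))).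
      by rewrite ler_peMr// mulr_ge0 ?expR_ge0.
    by ring.
  by rewrite ler_wpM2l ?expR_ge0.
apply/ler_addgt0Pr => e e0.
have a0 : 0 < e / (E + 1) by rewrite divr_gt0// ltr_wpDl.
apply: le_trans (key _ a0) _; rewrite lerD2l.
by rewrite -mulrA ger_pMr// mulrC ler_pdivrMr ?mul1r ?lerDl// ltr_wpDl.
Qed.

End projection_weight.

(** * Null sets and scaling *)

Section null_sets.
Context {R : realType}.
Local Notation T := (measurableTypeR R).
Local Notation circle := (@circle R).
Local Notation leb := (@lebesgue_measure R).

Lemma dominates_null (mu nu : {measure set T -> \bar R}) (Z : set T) :
  mu `<< nu -> measurable Z -> nu Z = 0%E -> mu Z = 0%E.
Proof.
move=> mu_nu mZ Z0; apply: (mu_nu Z) => // A mA AZ.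
by apply/eqP; rewrite -measure_le0 -Z0 le_measure ?inE.
Qed.

Lemma dominates_lambda_null (nu : {measure set T -> \bar R}) (Z : set T) :
  nu `<< lambda -> measurable Z -> leb (Z `&` circle) = 0%E -> nu Z = 0%E.
Proof.
move=> nu_l mZ Z0; apply: (nu_l Z) => // A mA AZ; rewrite /lambda.
suff -> : leb (A `&` circle) = 0%E by rewrite mule0.
apply/eqP; rewrite -measure_le0 -Z0 le_measure ?inE//; try exact: measurableI.
by apply: setSI.
Qed.

Lemma measure_circle_diff (nu : {measure set T -> \bar R}) (A Z : set T) :
  measurable A -> measurable Z -> nu (~` circle) = 0%E -> nu Z = 0%E ->
  nu ((A `\` Z) `&` circle) = nu A.
Proof.
move=> mA mZ nc Z0.
have mAZ : measurable ((A `\` Z) `&` circle).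
  by apply: measurableI => //; exact: measurableD.
have mC : measurable (~` circle) by exact: measurableC.
apply/eqP; rewrite eq_le; apply/andP; split.
  by apply: le_measure; rewrite ?inE// => t [[]].
have sub : A `<=` ((A `\` Z) `&` circle) `|` (Z `|` ~` circle).
  move=> t At; have [Zt|nZt] := pselect (Z t); first by right; left.
  by have [ct|nct] := pselect (circle t); [left|right; right].
apply: (@le_trans _ _ (nu (((A `\` Z) `&` circle) `|` (Z `|` ~` circle)))).
  by apply: le_measure; rewrite ?inE//; apply: measurableU => //; exact: measurableU.
have mZC : measurable (Z `|` ~` circle) by exact: measurableU.
have h1 : (nu (Z `|` ~` circle) <= nu Z + nu (~` circle))%E by exact: measureU2.
have h2 : (nu (((A `\` Z) `&` circle) `|` (Z `|` ~` circle)) <=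
  nu ((A `\` Z) `&` circle) + nu (Z `|` ~` circle))%E by exact: measureU2.
apply: le_trans h2 _; rewrite -[leRHS]adde0 leeD2l//.
by apply: le_trans h1 _; rewrite Z0 nc adde0.
Qed.

Lemma lp_error_scale (mu nu : {finite_measure set T -> \bar R}) (a p : R)
    (f : R -> R[i]) : 0 < a ->
  (forall A : set T, measurable A -> nu A = (a%:E * mu A)%E) ->
  measurable_fun [set: T] (fun t => complex.Re (f t)) ->
  measurable_fun [set: T] (fun t => complex.Im (f t)) ->
  lp_error nu p f = (a%:E * lp_error mu p f)%E.
Proof.
move=> a0 nuE mR mI; rewrite /lp_error.
rewrite (@eq_measure_integral _ _ _ setT (mscale (NngNum (ltW a0)) mu)).
  rewrite ge0_integral_mscale//.
    by apply/measurable_EFinP; exact: measurable_cmod_one_sub.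
  by move=> t _; rewrite lee_fin powR_ge0.
by move=> A mA _; exact: nuE.
Qed.

End null_sets.

(** * Comparison of the two errors *)

Section comparison.
Context {R : realType}.
Local Notation T := (measurableTypeR R).
Local Notation circle := (@circle R).
Local Notation leb := (@lebesgue_measure R).
Variables (mu nu : {finite_measure set T -> \bar R}) (p : R) (phi : R -> R[i]).
Hypothesis mu_circle : mu (~` circle) = 0%E.
Hypothesis nu_circle : nu (~` circle) = 0%E.
Hypothesis nu_ac : nu `<< lambda.
Hypothesis mu_nu : mu `<< nu.
Hypothesis p1 : 1 <= p.
Hypothesis phiP : metric_projection nu p S1 phi.

Local Notation V := (fun t => cmod (1 - phi t) `^ p).
Local Notation dnu := (fine (d_ p nu S1)).
Local Notation dmu := (fine (d_ p mu S1)).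
Let p0 : 0 < p. Proof. exact: lt_le_trans p1. Qed.
Let V0 t : circle t -> 0 <= V t. Proof. by move=> _; exact: powR_ge0. Qed.
Let mV : measurable_fun circle V := projection_measurable phiP.
Let mEV : measurable_fun circle (EFin \o V).
Proof. by apply/measurable_EFinP; exact: mV. Qed.

Lemma error_circle :
  lp_error mu p phi = (\int[mu]_(t in circle) (V t)%:E)%E.
Proof. by have [mR mI] := projection_measurable_Re_Im phiP; exact: lp_error_circle. Qed.

Lemma projection_measurable_preimage (B : set R) : measurable B ->
  measurable (circle `&` V @^-1` B : set T).
Proof. by move=> mB; exact: mV. Qed.

(** V vanishes nu-almost everywhere, and mu-null sets include the nu-null
    ones. *)
Lemma error_eq0 : dnu = 0 -> lp_error mu p phi = 0%E.
Proof.
move=> d0; rewrite error_circle.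
pose Z : set T := circle `&` V @^-1` (~` [set 0]).
have mZ : measurable Z by apply: projection_measurable_preimage; exact: measurableC.
have nuZ : nu Z = 0%E.
  have int0 : (\int[nu]_(t in circle) `|(V t)%:E| = 0)%E.
    under eq_integral do rewrite /= ger0_norm ?powR_ge0//.
    by rewrite projection_integral// d0.
  have [+ _] := ae_eq_integral_abs nu measurable_circle mEV.
  move=> /(_ int0) [N [mN N0 sub]].
  apply/eqP; rewrite -measure_le0 -N0; apply: le_measure; rewrite ?inE// => t [ct Vt].
  by apply: sub => /= /(_ ct) [].
have muZ := dominates_null mu_nu mZ nuZ.
rewrite (@ge0_negligible_integral _ _ _ mu circle Z)//.
apply: integral0_eq => t [ct nZt].
have [->//|Vt] := eqVneq (V t) 0.
by exfalso; apply: nZt; split=> //; exact/eqP.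
Qed.

(** This is the case f = 0 of [error_lower_bound], which applies whenever the
    error is finite. *)
Lemma error_ge : 0 < dnu -> (d_ p mu S1 <= lp_error mu p phi)%E.
Proof.
move=> d0; rewrite error_circle.
have I0 : (0 <= \int[mu]_(t in circle) (V t)%:E)%E.
  by apply: integral_ge0 => t ct; rewrite lee_fin V0.
have [|] := ltP (\int[mu]_(t in circle) (V t)%:E)%E +oo%E; last first.
  by rewrite leye_eq => /eqP ->; exact: leey.
move=> fin; have iV : mu.-integrable circle (EFin \o V).
  apply/integrableP; split; first exact: mEV.
  by under eq_integral do rewrite /= ger0_norm ?powR_ge0//.
have := error_lower_bound nu_circle p1 phiP mu_circle d0 iV (bm_cst 0).
rewrite mean_cst expR0 mulr1.
under [X in Rintegral _ _ X]eq_fun do rewrite mul1r.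
by rewrite -lee_fin (EFin_Rintegral iV) fineK ?d_fin_num.
Qed.

(** Equality in the case f = 0 makes the first-order comparison available for
    mu, so V mu and V nu are both multiples of Lebesgue measure. Dividing by V
    is done with the bounded functions 1_A / max (1/(n+1), V), whose products
    with V increase to the indicator of A off the zero set of V. *)
Lemma proportional_of_equality : (0 < d_ p mu S1)%E ->
  d_ p mu S1 = lp_error mu p phi ->
  forall A : set T, measurable A -> nu A = ((dnu / dmu)%:E * mu A)%E.
Proof.
move=> D0 DE A mA.
have dnu0 : 0 <= dnu by rewrite fine_ge0// d_ge0.
have dnu_gt0 : 0 < dnu.
  rewrite lt_neqAle dnu0 andbT; apply/eqP => /esym /error_eq0 e0.
  by move: D0; rewrite DE e0 ltxx.
have dmuE : d_ p mu S1 = dmu%:E by rewrite fineK ?d_fin_num.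
have dmu0 : 0 < dmu by rewrite -lte_fin -dmuE.
have intV : (\int[mu]_(t in circle) (V t)%:E = dmu%:E)%E.
  by rewrite -error_circle -DE dmuE.
have iV : mu.-integrable circle (EFin \o V).
  apply/integrableP; split; first exact: mEV.
  by under eq_integral do rewrite /= ger0_norm ?powR_ge0//; rewrite intV ltry.
have mu_mean f : bounded_measurable f ->
    \int[mu]_(t in circle) (f t * V t) = dmu * mean f.
  apply: (mean_eq_of_szego iV V0); first by rewrite /Rintegral intV.
  by move=> g bg; exact: (error_lower_bound nu_circle p1 phiP).
have nu_mean f : bounded_measurable f ->
    \int[nu]_(t in circle) (f t * V t) = dnu * mean f.
  exact: projection_mean.
(* The zero set of V is Lebesgue-null, hence null for nu and mu: test V nu =
   dnu lambda on its indicator. *)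
pose Z : set T := circle `&` V @^-1` [set 0].
have mZ : measurable Z by exact: projection_measurable_preimage.
have nuZ : nu Z = 0%E.
  apply: (dominates_lambda_null nu_ac mZ).
  have := nu_mean _ (bm_indic mZ).
  rewrite (@eq_Rintegral _ _ _ nu circle (cst 0)); last first.
    move=> t ct; rewrite indicE; have [|] := boolP (t \in Z); last by rewrite mul0r.
    by rewrite inE => -[_ /= ->]; rewrite mulr0.
  rewrite Rintegral_cst// mul0r => /esym/eqP.
  rewrite mulf_eq0 gt_eqF//= /mean mulf_eq0 invr_eq0 gt_eqF ?twopi_gt0//=.
  rewrite /Rintegral (integral_indic leb measurable_circle mZ) => /eqP.
  have fin : leb (Z `&` circle) \is a fin_num.
    rewrite ge0_fin_numE//; apply: (@le_lt_trans _ _ (leb circle)).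
      by apply: le_measure; rewrite ?inE//; exact: measurableI.
    by rewrite leb_circle ltry.
  by move=> f0; rewrite -(fineK fin) f0.
have muZ := dominates_null mu_nu mZ nuZ.
pose h n t : R := (Num.max (harmonic n) (V t))^-1.
have n0 n : 0 < harmonic n :> R by exact: harmonic_gt0.
have max0 n t : 0 < Num.max (harmonic n) (V t) by rewrite lt_max n0.
have bh n : bounded_measurable (h n) by exact: bm_invr_max.
have bAh n := bmM (bm_indic mA) (bh n).
have lim (rho : {finite_measure set T -> \bar R}) :
    (\int[rho]_(t in circle) (\1_A t * h n t * V t))%R @[n --> \oo] -->
    (\int[rho]_(t in circle) (\1_(A `\` Z) t))%R.
  apply: (@Rintegral_dominated _ _ _ _ (cst 1)).
  - by move=> n; apply: measurable_funM; [exact: (bAh n).1|exact: mV].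
  - exact: (bm_indic (measurableD mA mZ)).1.
  - by apply: integrable_fin; exact: bm_cst.
  - move=> n t ct; rewrite -mulrA normrM.
    rewrite mulr_ile1//.
      by rewrite indicE; case: (_ \in _); rewrite ?normr1 ?normr0.
    rewrite ger0_norm; last by rewrite mulr_ge0 ?powR_ge0// invr_ge0 ltW.
    by rewrite mulrC ler_pdivrMr// mul1r le_max lexx orbT.
  - move=> t ct; have [Vt|Vt] := eqVneq (V t) 0.
      have tZ : t \in Z by rewrite inE; split.
      have -> : \1_(A `\` Z) t = 0 :> R by rewrite indicE in_setD tZ andbF.
      by under eq_fun do rewrite Vt mulr0; exact: cvg_cst.
    have Vt0 : 0 < V t by rewrite lt_neqAle eq_sym Vt powR_ge0.
    have -> : \1_(A `\` Z) t = \1_A t :> R.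
      rewrite !indicE in_setD (_ : t \notin Z) ?andbT//.
      by apply/negP; rewrite inE => -[_ /= V00]; move: Vt; rewrite V00 eqxx.
    apply: cvg_near_cst; near=> n.
    have hn : harmonic n <= V t.
      near: n; have /cvgrPdist_lt/(_ _ Vt0) := @cvg_harmonic R.
      by apply: filterS => n; rewrite sub0r normrN gtr0_norm ?n0 => [/ltW|].
    by rewrite /h max_r// mulfVK// gt_eqF.
have ratio n : \int[nu]_(t in circle) (\1_A t * h n t * V t) =
    dnu / dmu * \int[mu]_(t in circle) (\1_A t * h n t * V t).
  by rewrite nu_mean// mu_mean// mulrA mulfVK// gt_eqF.
have := lim nu; under eq_fun do rewrite ratio.
move=> lim_nu.
have lim_mu : (dnu / dmu * \int[mu]_(t in circle) (\1_A t * h n t * V t))%R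
    @[n --> \oo] --> (dnu / dmu * \int[mu]_(t in circle) (\1_(A `\` Z) t))%R.
  by apply: cvgM; [exact: cvg_cst|exact: lim].
have : \int[nu]_(t in circle) (\1_(A `\` Z) t) =
    dnu / dmu * \int[mu]_(t in circle) (\1_(A `\` Z) t).
  by rewrite -(cvg_lim _ lim_nu)// -(cvg_lim _ lim_mu).
have mAZ : measurable (A `\` Z) by exact: measurableD.
rewrite /Rintegral (integral_indic nu measurable_circle mAZ).
rewrite (integral_indic mu measurable_circle mAZ) !measure_circle_diff// => E.
by rewrite -(@fineK _ (nu A)) ?fin_num_measure// E EFinM fineK// fin_num_measure.
Unshelve. all: by end_near. Qed.

(** The errors of all polynomials and of phi are scaled by a, so phi also
    minimizes the error for mu. Positivity of d_p(mu) passes to d_p(nu), which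
    gives the other inequality. *)
Lemma equality_of_proportional (a : R) : 0 < a ->
  (forall A : set T, measurable A -> nu A = (a%:E * mu A)%E) ->
  (0 < d_ p mu S1)%E -> d_ p mu S1 = lp_error mu p phi.
Proof.
move=> a0 nuE D0.
have [mR mI] := projection_measurable_Re_Im phiP.
have a_cancel x y : (a%:E * x <= a%:E * y)%E -> (x <= y)%E.
  by rewrite lee_pmul2l.
have scale tau : trig_span S1 tau ->
    lp_error nu p tau = (a%:E * lp_error mu p tau)%E.
  move=> St; have [? ?] := trig_span_measurable St.
  exact: lp_error_scale.
have dnu_le tau : trig_span S1 tau -> (d_ p nu S1 <= lp_error nu p tau)%E.
  by move=> St; apply: ereal_inf_lbound; exists tau.
have dmu_le tau : trig_span S1 tau -> (d_ p mu S1 <= lp_error mu p tau)%E.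
  by move=> St; apply: ereal_inf_lbound; exists tau.
apply/eqP; rewrite eq_le; apply/andP; split.
  apply: error_ge; rewrite -lte_fin fineK ?d_fin_num//.
  apply: (@lt_le_trans _ _ (a%:E * d_ p mu S1)%E); first by rewrite mule_gt0.
  apply: le_ereal_inf_tmp => _ [tau St <-].
  by rewrite scale// lee_pmul2l// dmu_le.
apply: le_ereal_inf_tmp => _ [tau St <-]; apply: a_cancel.
rewrite -(scale tau St) -(lp_error_scale p a0 nuE mR mI).
by have [_ ->] := phiP; exact: dnu_le.
Qed.

End comparison.

Unset Implicit Arguments.
Set Strict Implicit.
Set Printing Implicit Defensive.

(* phi_nu ranges over the representatives of the metric projection for nu, so
   that lp_error mu p phi_nu is the error d_p(nu, mu; S1). *)
Theorem theorem5p11 (R : realType) (p : R) (hp : 1 <= p)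
    (mu nu : {finite_measure set (measurableTypeR R) -> \bar R})
    (hmu : circle_measure mu) (hnu : circle_measure nu)
    (mu_ac : mu `<< lambda) (nu_ac : nu `<< lambda) (mu_nu : mu `<< nu)
    (phi_nu : R -> R[i]) (hphi : metric_projection nu p S1 phi_nu) :
  (lp_error mu p phi_nu = 0%E \/
   (d_ p mu S1 <= lp_error mu p phi_nu /\ lp_error mu p phi_nu <= +oo)%E) /\
  ((0 < d_ p mu S1)%E ->
   (d_ p mu S1 = lp_error mu p phi_nu <->
    exists a : R, 0 < a /\
      forall A : set (measurableTypeR R), measurable A ->
        nu A = (a%:E * mu A)%E)).
Proof.
have [mu_c mu_pos] := hmu; have [nu_c nu_pos] := hnu.
have p0 : 0 < p by exact: lt_le_trans hp.
split.
  have : 0 <= fine (d_ p nu S1) by rewrite fine_ge0// d_ge0.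
  rewrite le_eqVlt => /predU1P[/esym d0|d0].
    by left; exact: (error_eq0 mu_c nu_c mu_nu hp hphi).
  by right; split; [exact: (error_ge mu_c nu_c hp hphi)|exact: leey].
move=> D0; split=> [DE|[a [a0 nuE]]]; last first.
  exact: (equality_of_proportional mu_c nu_c hp hphi a0 nuE).
have nuE := proportional_of_equality mu_c nu_c nu_ac mu_nu hp hphi D0 DE.
exists (fine (d_ p nu S1) / fine (d_ p mu S1)); split=> //.
have mu_fin : mu circle \is a fin_num.
  by rewrite fin_num_measure//; exact: measurable_circle.
move: nu_pos; rewrite nuE; last exact: measurable_circle.
by rewrite -(fineK mu_fin) -EFinM lte_fin pmulr_lgt0// -lte_fin fineK.
Qed.
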